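(* Let $G$ be a minimally almost periodic SIN topological group admitting a non-trivial strongly continuous unitary representation. If $G$ is amenable, then $G$ does not have strong property $(T)$.
   Context: All topological groups are Hausdorff. A topological group is SIN if conjugation-invariant neighbourhoods of the identity form a neighbourhood basis at the identity. $G$ is minimally almost periodic if it has no non-trivial continuous finite-dimensional unitary representations (a representation is trivial if every group element acts as the identity). $G$ is amenable if every continuous action of $G$ on a (non-empty) compact Hausdorff space admits an invariant regular Borel probability measure. A subset $Q\subseteq G$ is a Kazhdan set if there is $\varepsilon>0$ such that every strongly continuous unitary representation $\pi$ of $G$ that has a unit vector $\xi$ with $\|\xi-\pi_g\xi\|<\varepsilon$ for all $g\in Q$ has an invariant unit vector. $G$ has strong property $(T)$ if it has a finite Kazhdan set. *)

(* Defs.v *)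
From HB Require Import structures.
From mathcomp Require Import all_boot all_order all_algebra.
From mathcomp Require Import all_classical all_reals all_analysis.
From mathcomp Require Import complex.

Set Implicit Arguments.
Unset Strict Implicit.
Unset Printing Implicit Defensive.

Import Order.TTheory GRing.Theory Num.Theory.
Import numFieldNormedType.Exports.

Local Open Scope classical_set_scope.
Local Open Scope ring_scope.
Local Open Scope complex_scope.

HB.structure Definition PreTopologicalGroup := {G of Topological G & Group G}.

HB.mixin Record PreTopologicalGroup_isTopologicalGroup G
    & PreTopologicalGroup G := {
  mulg_continuous : continuous (fun p : G * G => (p.1 * p.2)%g) ;
  invg_continuous : continuous (fun x : G => (x^-1)%g)
}.

(* Not assumed Hausdorff: use [hausdorff_space]. *)
#[short(type="topologicalGroupType")]
HB.structure Definition TopologicalGroup :=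
  {G of PreTopologicalGroup G & PreTopologicalGroup_isTopologicalGroup G}.

(* Complex Hilbert spaces; [inner] is linear on the left and conjugate-linear
   on the right. *)
HB.mixin Record CompleteNormedModule_isHilbert (R : realType) H
    & CompleteNormedModule R[i] H := {
  inner : {dot H for @Num.conj R[i]} ;
  inner_norm : forall u : H, `|u| ^+ 2 = inner u u
}.

#[short(type="hilbertType")]
HB.structure Definition Hilbert (R : realType) :=
  {H of CompleteNormedModule R[i] H & CompleteNormedModule_isHilbert R H}.

Definition finite_dimensional (R : realType) (H : hilbertType R) : Prop :=
  exists (n : nat) (b : 'I_n -> H), forall u : H,
    exists c : 'I_n -> R[i], u = \sum_(i < n) c i *: b i.

Record unitary (R : realType) (H : hilbertType R) (U : H -> H) : Prop := {
  unitary_linear : linear U ;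
  unitary_inner : forall u v : H, inner (U u) (U v) = inner u v ;
  unitary_surj : forall v : H, exists u : H, U u = v
}.

Record unitary_rep (R : realType) (G : groupType) (H : hilbertType R)
    (pi : G -> H -> H) : Prop := {
  rep_unitary : forall g : G, unitary (pi g) ;
  rep1 : forall u : H, pi 1%g u = u ;
  repM : forall (g h : G) (u : H), pi (g * h)%g u = pi g (pi h u)
}.

Definition strongly_continuous (R : realType) (G : topologicalGroupType)
    (H : hilbertType R) (pi : G -> H -> H) : Prop :=
  forall u : H, continuous (fun g : G => pi g u).

Definition trivial_rep (R : realType) (G : groupType) (H : hilbertType R)
    (pi : G -> H -> H) : Prop :=
  forall (g : G) (u : H), pi g u = u.

Definition has_nontrivial_unitary_rep (R : realType)
    (G : topologicalGroupType) : Prop :=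
  exists (H : hilbertType R) (pi : G -> H -> H),
    [/\ unitary_rep pi, strongly_continuous pi & ~ trivial_rep pi].

(* On a finite-dimensional space the strong operator topology is the norm
   topology, so strong continuity is continuity as a map into U(n). *)
Definition minimally_almost_periodic (R : realType)
    (G : topologicalGroupType) : Prop :=
  forall (H : hilbertType R) (pi : G -> H -> H),
    finite_dimensional H -> unitary_rep pi -> strongly_continuous pi ->
    trivial_rep pi.

Definition conjugation_invariant (G : groupType) (V : set G) : Prop :=
  forall g x : G, V x -> V (g * x * g^-1)%g.

Definition SIN (G : topologicalGroupType) : Prop :=
  forall U : set G, nbhs (1%g : G) U ->
    exists V : set G,
      [/\ nbhs (1%g : G) V, conjugation_invariant V & V `<=` U].

Definition kazhdan_set (R : realType) (G : topologicalGroupType)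
    (Q : set G) : Prop :=
  exists2 e : R, 0 < e &
    forall (H : hilbertType R) (pi : G -> H -> H),
      unitary_rep pi -> strongly_continuous pi ->
      (exists xi : H, `|xi| = 1 /\
         forall g : G, Q g -> `|xi - pi g xi| < e%:C) ->
      exists eta : H, `|eta| = 1 /\ forall g : G, pi g eta = eta.

Definition strong_property_T (R : realType) (G : topologicalGroupType) : Prop :=
  exists2 Q : set G, finite_set Q & kazhdan_set R Q.

Record continuous_action (G : topologicalGroupType) (X : topologicalType)
    (act : G -> X -> X) : Prop := {
  act1 : forall x : X, act 1%g x = x ;
  actM : forall (g h : G) (x : X), act (g * h)%g x = act g (act h x) ;
  act_continuous : continuous (fun p : G * X => act p.1 p.2)
}.

Notation borel X := (g_sigma_algebraType (@open X)).

Definition regular_measure (R : realType) (X : ptopologicalType)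
    (mu : {measure set (borel X) -> \bar R}) : Prop :=
  forall A : set X, measurable (A : set (borel X)) ->
    mu A = ereal_inf [set mu U | U in [set U : set X | open U /\ A `<=` U]] /\
    mu A = ereal_sup [set mu K | K in [set K : set X | compact K /\ K `<=` A]].

Definition invariant_measure (R : realType) (G : topologicalGroupType)
    (X : ptopologicalType) (act : G -> X -> X)
    (mu : {measure set (borel X) -> \bar R}) : Prop :=
  forall (g : G) (A : set X), measurable (A : set (borel X)) ->
    mu (act g @^-1` A) = mu A.

(* A [ptopologicalType] is a topological space with a chosen point, i.e. a
   non-empty one; the point plays no role. *)
Definition amenable (R : realType) (G : topologicalGroupType) : Prop :=
  forall (X : ptopologicalType) (act : G -> X -> X),
    compact [set: X] -> hausdorff_space X -> continuous_action act ->
    exists mu : probability (borel X) R,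
      regular_measure mu /\ invariant_measure act mu.

(* Main.v *)
(** Suppose [Q] is a finite Kazhdan set and let [pi] be a nontrivial unitary
    representation, cut down to a subspace without nonzero invariant vectors.
    Let [K] be the Hilbert space of the forms [x |-> <T x, x>], [T] a
    Hilbert-Schmidt operator, on which [G] acts by conjugation.  An invariant
    form in [K] has finite-dimensional eigenspaces, on which minimal almost
    periodicity makes [G] act trivially; hence it is zero.  So the sum [M] of
    the action over a symmetric multiset [s] containing [Q] has norm less than
    [rho < #s] on [K], and [q = \sum_j rho^-j M^j k] (with [k >= 0]) is a positive
    quadratic form with [M q <= rho q].  A logarithm of [q] would satisfy
    [#s log q - M (log q) >= c > 0] while [log q - g (log q)] is bounded; the sum
    [b] of the infimal convolutions of [|.|^2] with geometrically growing
    multiples of [q] has both properties.  Amenability is applied to the compact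
    space of the functions [h |-> b (h^-1 xi) - b (g^-1 h^-1 xi)], [g] in [Q],
    and their limits, on which [G] acts continuously because it is SIN: an
    invariant mean gives [0 >= c]. *)

(* The logarithm is replaced because of continuity, not because of superharmonicity. By Jensen the
   pointwise [log (q x)] would satisfy the first inequality, but [q] may come arbitrarily close to
   zero on the unit sphere, and then nothing controls the modulus of continuity of the differences.
   A function with the parallelogram law that is bounded by [m |.|^2] has a modulus depending on [m]
   alone. So an operator logarithm is wanted: the infimal convolution of [c q] and [|.|^2] is the
   form of [c q / (1 + c q)], whose integral against [dc / c] is logarithmic in [q]; the geometric
   scales discretise this integral. The variational definition needs no functional calculus. The
   uniform modulus is also where SIN enters: it gives equicontinuity under left translations, that
   is, joint continuity of the action. A Hilbert-Schmidt form cannot in general be bounded below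
   along a whole orbit. Hence [q], and with it [b], is made for one finite set of unit vectors at a
   time; the bound [m] on the differences must not depend on that set, so that compactness yields a
   limit valid on the entire orbit. *)
Require Import Defs.
From HB Require Import structures.
From mathcomp Require Import all_boot all_order all_algebra.
From mathcomp Require Import all_classical all_reals all_analysis.
From mathcomp Require Import measurable_realfun complex ring lra.

Set Implicit Arguments.
Unset Strict Implicit.
Unset Printing Implicit Defensive.

Import Order.TTheory GRing.Theory Num.Theory.
Import numFieldNormedType.Exports.

Local Open Scope classical_set_scope.
Local Open Scope ring_scope.
Local Open Scope complex_scope.

Local Notation Re := complex.Re.
Local Notation Im := complex.Im.

(** * The Jordan-von Neumann theorem *)

Section ComplexNumbers.
Variable R : realType.
Implicit Types (c d : R[i]) (a : R).

Definition normc2 c : R := Re c ^+ 2 + Im c ^+ 2.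

Lemma ReD c d : Re (c + d) = Re c + Re d. Proof. by case: c; case: d. Qed.
Lemma ImD c d : Im (c + d) = Im c + Im d. Proof. by case: c; case: d. Qed.
Lemma ReN c : Re (- c) = - Re c. Proof. by case: c. Qed.
Lemma ImN c : Im (- c) = - Im c. Proof. by case: c. Qed.
Lemma ReM c d : Re (c * d) = Re c * Re d - Im c * Im d.
Proof. by case: c; case: d. Qed.
Lemma ImM c d : Im (c * d) = Re c * Im d + Im c * Re d.
Proof. by case: c => ? ?; case: d => ? ?. Qed.
Lemma conjCE c : (Num.conj c : R[i]) = Re c -i* Im c.
Proof.
have [-> | c0] := eqVneq c 0; first by rewrite conjC0 /= oppr0.
have c0' : `|c| != 0 by rewrite normr_eq0.
apply: (mulfI c0); rewrite -normCK sqr_normc.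
by case: c {c0 c0'} => x y; congr (_ * _).
Qed.
Lemma Re_conj c : Re (Num.conj c) = Re c. Proof. by rewrite conjCE. Qed.
Lemma Im_conj c : Im (Num.conj c) = - Im c. Proof. by rewrite conjCE. Qed.
Lemma complex_ext c d : Re c = Re d -> Im c = Im d -> c = d.
Proof. by case: c => ? ?; case: d => ? ? /= -> ->. Qed.

Lemma conj_realC a : Num.conj a%:C = a%:C :> R[i].
Proof. by rewrite conjCE /= oppr0. Qed.

Lemma ReMr c a : Re (c * a%:C) = Re c * a.
Proof. by rewrite ReM /= mulr0 subr0. Qed.

Lemma normc2_ge0 c : 0 <= normc2 c.
Proof. by rewrite addr_ge0 ?sqr_ge0. Qed.
Lemma normc2M c d : normc2 (c * d) = normc2 c * normc2 d.
Proof. rewrite /normc2 ReM ImM; ring. Qed.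
Lemma normc2_conj c : normc2 (Num.conj c) = normc2 c.
Proof. by rewrite /normc2 Re_conj Im_conj sqrrN. Qed.
Lemma normc2N c : normc2 (- c) = normc2 c.
Proof. by rewrite /normc2 ReN ImN !sqrrN. Qed.
Lemma normc2R a : normc2 a%:C = a ^+ 2.
Proof. by rewrite /normc2 /= expr0n addr0. Qed.
Lemma normc2_eq0 c : normc2 c = 0 -> c = 0.
Proof.
move=> /eqP; rewrite paddr_eq0 ?sqr_ge0// !sqrf_eq0 => /andP[/eqP ? /eqP ?].
exact: complex_ext.
Qed.
Lemma normr_normc2 c : `|c| = (Num.sqrt (normc2 c))%:C.
Proof. exact: normc_def. Qed.
Lemma normr2_normc2 c : `|c| ^+ 2 = (normc2 c)%:C.
Proof. by rewrite add_Re2_Im2. Qed.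
Lemma mulcJ_normc2 c : c * Num.conj c = (normc2 c)%:C.
Proof. by rewrite -normCK normr2_normc2. Qed.

End ComplexNumbers.

Section JordanVonNeumann.
Variables (R : realType) (W : lmodType R[i]) (N : W -> R).
Hypothesis N_ge0 : forall x, 0 <= N x.
Hypothesis NZ : forall c x, N (c *: x) = normc2 c * N x.
Hypothesis N_par : forall x y, N (x + y) + N (x - y) <= 2 * (N x + N y).
Implicit Types x y z : W.

(** The assumed inequality at [x + y], [x - y] is the reverse inequality at [x], [y]. Only an
    inequality is assumed because the norm of a kernel space below is a supremum, for which one
    direction is direct. *)
Lemma parallelogram_eq x y : N (x + y) + N (x - y) = 2 * (N x + N y).
Proof.
apply/eqP; rewrite eq_le N_par /=.
have := N_par (x + y) (x - y).
have -> : x + y + (x - y) = (2%:R)%:C *: x.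
  by rewrite addrACA subrr addr0 rmorph_nat scaler_nat mulr2n.
have -> : x + y - (x - y) = (2%:R)%:C *: y.
  by rewrite opprD opprK addrACA subrr add0r rmorph_nat scaler_nat mulr2n.
rewrite !NZ normc2R; lra.
Qed.

Lemma quad_opp x : N (- x) = N x.
Proof. by rewrite -scaleN1r NZ normc2N normc2R expr1n mul1r. Qed.

Definition polar x y : R := (N (x + y) - N (x - y)) / 4.

Lemma polarC x y : polar x y = polar y x.
Proof. by rewrite /polar [x + y]addrC -(quad_opp (x - y)) opprB. Qed.

Lemma polar_diag x : polar x x = N x.
Proof.
have N0 : N 0 = 0 by rewrite -(scale0r 0) NZ normc2R expr0n mul0r.
have := parallelogram_eq x x; rewrite /polar subrr N0; lra.
Qed.

Lemma polarZZ c x y : polar (c *: x) (c *: y) = normc2 c * polar x y.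
Proof. by rewrite /polar -scalerDr -scalerBr !NZ mulrA mulrBr. Qed.

Lemma quadDE x y : N (x + y) = N x + N y + 2 * polar x y.
Proof. have := parallelogram_eq x y; rewrite /polar; lra. Qed.

Lemma polar_half x x' y : polar (x + x') y + polar (x - x') y = 2 * polar x y.
Proof.
have h1 := parallelogram_eq (x + y) x'; have h2 := parallelogram_eq (x - y) x'.
rewrite /polar.
have -> : x + x' + y = x + y + x' by rewrite addrAC.
have -> : x + x' - y = x - y + x' by rewrite addrAC.
have -> : x - x' + y = x + y - x' by rewrite addrAC.
have -> : x - x' - y = x - y - x' by rewrite addrAC.
lra.
Qed.

Lemma polar0l y : polar 0 y = 0.
Proof. by rewrite /polar add0r sub0r quad_opp subrr mul0r. Qed.

Lemma polarDl x x' y : polar (x + x') y = polar x y + polar x' y.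
Proof.
have h (z : W) : polar (z + z) y = 2 * polar z y.
  by have := polar_half z z y; rewrite subrr polar0l addr0.
pose a := (2^-1)%:C *: (x + x'); pose b := (2^-1)%:C *: (x - x').
have hlf (z : W) : (2^-1)%:C *: z + (2^-1)%:C *: z = z.
  rewrite -scalerDl -rmorphD /=.
  by rewrite (_ : 2^-1 + 2^-1 = 1) ?scale1r//; lra.
have ab : a + b = x.
  rewrite /a /b -scalerDr addrACA subrr addr0 scalerDr; exact: hlf.
have amb : a - b = x'.
  rewrite /a /b -scalerBr opprD opprK addrACA subrr add0r scalerDr; exact: hlf.
have := polar_half a b y; rewrite ab amb -h => ->; congr polar.
by rewrite /a hlf.
Qed.

Lemma polarNl x y : polar (- x) y = - polar x y.
Proof.
by apply/eqP; rewrite -addr_eq0 -polarDl addrC subrr polar0l.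
Qed.

Lemma polar_bound x y : `|polar x y| <= (N x + N y) / 2.
Proof.
have h := parallelogram_eq x y.
have h1 := N_ge0 (x + y); have h2 := N_ge0 (x - y).
by rewrite ler_norml /polar; apply/andP; split; lra.
Qed.

Lemma polarMn x y n : polar (x *+ n) y = n%:R * polar x y.
Proof.
elim: n => [|n IH]; first by rewrite mulr0n polar0l mul0r.
by rewrite mulrS polarDl IH mulrS mulrDl mul1r.
Qed.

(* [a |-> polar (a x) y - a (polar x y)] is additive, vanishes on the natural
   numbers and is bounded on [0, 1], hence is zero. *)
Lemma polarZl_real (a : R) x y : polar (a%:C *: x) y = a * polar x y.
Proof.
suff pos b : 0 <= b -> polar (b%:C *: x) y = b * polar x y.
  have [/pos //|/ltW a0] := leP 0 a.
  have := pos (- a); rewrite oppr_ge0 => /(_ a0).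
  rewrite rmorphN /= scaleNr polarNl mulNr => h; exact: oppr_inj.
move=> b0; pose B := (N x + N y) / 2 + `|polar x y|.
have small d : 0 <= d <= 1 -> `|polar (d%:C *: x) y - d * polar x y| <= B.
  move=> /andP[d0 d1]; apply: le_trans (ler_normB _ _) _; rewrite /B lerD//.
    apply: (le_trans (polar_bound _ _)); rewrite ler_pM2r ?invr_gt0// lerD2r.
    by rewrite NZ normc2R ler_piMl// expr_le1.
  by rewrite normrM ger0_norm// ler_piMl.
have key n : n%:R * `|polar (b%:C *: x) y - b * polar x y| <= B.
  have nb0 : 0 <= n%:R * b by rewrite mulr_ge0.
  have [lo hi] := andP (truncn_itv nb0).
  set p := Num.truncn (n%:R * b) in lo hi.
  pose d := n%:R * b - p%:R.
  have d01 : 0 <= d <= 1.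
    by move: hi; rewrite -addn1 natrD /d => hi; apply/andP; split; lra.
  have E : n%:R * (polar (b%:C *: x) y - b * polar x y) =
           polar (d%:C *: x) y - d * polar x y.
    have -> : d%:C *: x = (b%:C *: x) *+ n - x *+ p.
      rewrite /d rmorphB rmorphM !rmorph_nat scalerBl -scalerA !scaler_nat.
      by [].
    by rewrite polarDl polarNl !polarMn /d; ring.
  by rewrite -[n%:R]ger0_norm// -normrM E small.
apply/eqP; rewrite -subr_eq0 -normr_eq0; apply/eqP/le_anti.
rewrite normr_ge0 andbT; set z := `|_|; rewrite leNgt; apply/negP => z0.
have B0 : 0 <= B by rewrite addr_ge0// divr_ge0// addr_ge0.
have [_ hi] := andP (truncn_itv (divr_ge0 B0 (ltW z0))).
have := key (Num.truncn (B / z)).+1; rewrite leNgt => /negP; apply.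
by rewrite -ltr_pdivrMr.
Qed.

(** The imaginary part of [<x, y>] is [Re <x, i y>], the form being conjugate-linear on the
    right. *)
Definition polar_inner x y : R[i] :=
  polar x y +i* polar x ('i *: y).

Lemma polar_i x y : polar ('i *: x) y = - polar x ('i *: y).
Proof.
have i2 z : 'i *: ('i *: z) = - z :> W.
  by rewrite scalerA -expr2 sqr_i scaleN1r.
have n1 : normc2 ('i : R[i]) = 1 by rewrite /normc2 /= expr0n expr1n add0r.
have := polarZZ 'i x ('i *: y).
by rewrite i2 n1 mul1r polarC polarNl polarC => <-; rewrite opprK.
Qed.

Lemma polarZl c x y : polar (c *: x) y = Re c * polar x y - Im c * polar x ('i *: y).
Proof.
rewrite {1}[c]complexE scalerDl polarDl polarZl_real mulrC.
by rewrite ['i%C * _]mulrC -scalerA polarZl_real polar_i mulrN mulrC.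
Qed.

Lemma polar_inner_herm x y : polar_inner x y = Num.conj (polar_inner y x).
Proof.
apply: complex_ext; first by rewrite Re_conj /= polarC.
by rewrite Im_conj /= -polar_i polarC.
Qed.

Lemma polar_inner_linear y : linear (polar_inner^~ y).
Proof.
move=> c x z; apply: complex_ext; rewrite /= !polarDl polarZl /=.
  by rewrite ReD ReM /=.
rewrite ImD ImM /= scalerA -expr2 sqr_i scaleN1r.
by rewrite (polarC x (- y)) polarNl (polarC y) mulrN opprK.
Qed.

Lemma polar_inner_diag x : polar_inner x x = (N x)%:C.
Proof.
apply: complex_ext; rewrite /= ?polar_diag//.
by have := polar_i x x; rewrite polarC => h; lra.
Qed.

Lemma polar_CauchySchwarz x y : polar x y ^+ 2 <= N x * N y.
Proof.
have h t : 0 <= t ^+ 2 * N x + 2 * (t * polar x y) + N y.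
  have := N_ge0 (t%:C *: x + y).
  by rewrite quadDE NZ normc2R polarZl_real addrAC.
have [Nx0|Nx] := eqVneq (N x) 0.
  have [->|p0] := eqVneq (polar x y) 0; first by rewrite expr0n mulr_ge0.
  (* When [N x = 0] the polynomial in [t] is affine; at this [t] its value is [- N y - 2]. *)
  have := h (- (N y + 1) / polar x y); rewrite divfK // Nx0.
  by have := N_ge0 y; lra.
have Nxp : 0 < N x by rewrite lt_def Nx N_ge0.
have := h (- polar x y / N x) => {}h.
have := mulr_ge0 (N_ge0 x) h.
rewrite (_ : N x * (_ + _) = N x * N y - polar x y ^+ 2); last by field.
by rewrite subr_ge0.
Qed.

Lemma sqrt_quad_triangle x y :
  Num.sqrt (N (x + y)) <= Num.sqrt (N x) + Num.sqrt (N y).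
Proof.
have s2 z : Num.sqrt (N z) ^+ 2 = N z by rewrite sqr_sqrtr.
rewrite -(@ler_pXn2r _ 2) ?nnegrE ?addr_ge0 ?sqrtr_ge0//.
rewrite sqrrD !s2 quadDE.
suff : polar x y <= Num.sqrt (N x) * Num.sqrt (N y) by rewrite mulr2n; lra.
rewrite -sqrtrM//; apply: le_trans (ler_norm _) _.
by rewrite -sqrtr_sqr ler_wsqrtr// polar_CauchySchwarz.
Qed.

End JordanVonNeumann.

(** * Hilbert spaces from quadratic norms *)

(** Data that cut a Hilbert space out of an ambient module. The laws are asked of members only,
    since a norm given by a supremum means nothing elsewhere. The instances are closed subspaces and
    reproducing kernel spaces. *)
Record quadspace (R : realType) (V : lmodType R[i]) := QuadSpace {
  qmem : pred V ;
  qnorm : V -> R ;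
  qmem0 : qmem 0 ;
  qmemD : forall x y, qmem x -> qmem y -> qmem (x + y) ;
  qmemZ : forall c x, qmem x -> qmem (c *: x) ;
  qnorm_ge0 : forall x, qmem x -> 0 <= qnorm x ;
  qnorm_eq0 : forall x, qmem x -> qnorm x = 0 -> x = 0 ;
  qnormZ : forall c x, qmem x -> qnorm (c *: x) = normc2 c * qnorm x ;
  qnorm_par : forall x y, qmem x -> qmem y ->
    qnorm (x + y) + qnorm (x - y) <= 2 * (qnorm x + qnorm y) ;
  qnorm_complete : forall F : set_system V, ProperFilter F -> F qmem ->
    (forall e : R, 0 < e ->
      exists2 z, qmem z & F [set x | qnorm (z - x) < e]) ->
    exists2 y, qmem y & forall e : R, 0 < e -> F [set x | qnorm (y - x) < e]
}.

Section HilbertOf.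
Variables (R : realType) (V : lmodType R[i]) (D : quadspace V).

Definition hilbert_of := {x : V | qmem D x}.
HB.instance Definition _ := Choice.on hilbert_of.
Implicit Types x y : hilbert_of.

Definition hof_add x y : hilbert_of :=
  exist _ (val x + val y) (qmemD (valP x) (valP y)).
Definition hof_scale (c : R[i]) x : hilbert_of :=
  exist _ (c *: val x) (qmemZ c (valP x)).
Definition hof_zero : hilbert_of := exist _ 0 (qmem0 D).
Definition hof_opp x : hilbert_of := hof_scale (-1) x.

Fact hof_addA : associative hof_add.
Proof. by move=> x y z; apply: val_inj => /=; rewrite addrA. Qed.
Fact hof_addC : commutative hof_add.
Proof. by move=> x y; apply: val_inj => /=; rewrite addrC. Qed.
Fact hof_add0 : left_id hof_zero hof_add.
Proof. by move=> x; apply: val_inj => /=; rewrite add0r. Qed.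
Fact hof_addN : left_inverse hof_zero hof_opp hof_add.
Proof. by move=> x; apply: val_inj; rewrite /= scaleN1r addNr. Qed.
HB.instance Definition _ :=
  GRing.isZmodule.Build hilbert_of hof_addA hof_addC hof_add0 hof_addN.

Fact hof_scaleA c d x : hof_scale c (hof_scale d x) = hof_scale (c * d) x.
Proof. by apply: val_inj => /=; rewrite scalerA. Qed.
Fact hof_scale1 : left_id 1 hof_scale.
Proof. by move=> x; apply: val_inj => /=; rewrite scale1r. Qed.
Fact hof_scaleDr : right_distributive hof_scale +%R.
Proof. by move=> c x y; apply: val_inj => /=; rewrite scalerDr. Qed.
Fact hof_scaleDl x : {morph hof_scale^~ x : c d / c + d}.
Proof. by move=> c d; apply: val_inj => /=; rewrite scalerDl. Qed.
HB.instance Definition _ := GRing.Zmodule_isLmodule.Build R[i] hilbert_of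
  hof_scaleA hof_scale1 hof_scaleDr hof_scaleDl.

Lemma hof_valD x y : val (x + y) = val x + val y. Proof. by []. Qed.
Lemma hof_valN x : val (- x) = - val x.
Proof. by rewrite -scaleN1r. Qed.
Lemma hof_valB x y : val (x - y) = val x - val y.
Proof. by rewrite hof_valD hof_valN. Qed.

Definition hof_quad x : R := qnorm D (val x).

Fact hof_quad_ge0 x : 0 <= hof_quad x.
Proof. exact: qnorm_ge0 (valP x). Qed.
Fact hof_quadZ c x : hof_quad (c *: x) = normc2 c * hof_quad x.
Proof. exact: qnormZ (valP x). Qed.
Fact hof_quad_par x y :
  hof_quad (x + y) + hof_quad (x - y) <= 2 * (hof_quad x + hof_quad y).
Proof.
by rewrite /hof_quad hof_valB; exact: (qnorm_par (valP x) (valP y)).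
Qed.

Definition hof_norm x : R[i] := (Num.sqrt (hof_quad x))%:C.

Fact hof_normD x y : hof_norm (x + y) <= hof_norm x + hof_norm y.
Proof.
rewrite /hof_norm -rmorphD /= lecR.
exact: sqrt_quad_triangle hof_quad_ge0 hof_quadZ hof_quad_par x y.
Qed.
Fact hof_normZ c x : hof_norm (c *: x) = `|c| * hof_norm x.
Proof.
by rewrite /hof_norm hof_quadZ sqrtrM ?normc2_ge0// normr_normc2 rmorphM.
Qed.
Fact hof_norm_eq0 x : hof_norm x = 0 -> x = 0.
Proof.
move=> /complexI /eqP; rewrite sqrtr_eq0 => x0; apply: val_inj.
apply: (qnorm_eq0 (valP x)); apply/eqP; rewrite eq_le x0.
exact: qnorm_ge0 (valP x).
Qed.
HB.instance Definition _ := Lmodule_isNormed.Build R[i] hilbert_of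
  hof_normD hof_normZ hof_norm_eq0.

Lemma hof_normE x : `|x| = (Num.sqrt (hof_quad x))%:C. Proof. by []. Qed.

Lemma hof_ball x (e : R) : 0 < e ->
  ball x e%:C = [set y | hof_quad (x - y) < e ^+ 2].
Proof.
move=> e0; rewrite -ball_normE; apply/seteqP; split=> y /=.
all: rewrite hof_normE ltcR => h.
  rewrite -[ltLHS]sqr_sqrtr ?hof_quad_ge0//.
  by rewrite ltr_pXn2r// nnegrE ?sqrtr_ge0// ltW.
by rewrite -(@ltr_pXn2r _ 2)// ?nnegrE ?sqrtr_ge0 ?sqr_sqrtr ?hof_quad_ge0// ltW.
Qed.

Fact hof_complete (F : set_system hilbert_of) :
  ProperFilter F -> cauchy F -> cvg F.
Proof.
move=> PF /cauchyP cF.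
have [|e e0|y Py hy] := @qnorm_complete _ _ D (val @ F) _.
- by apply: (@filterS _ F) filterT => x _; exact: valP.
- have e0' : 0 < (Num.sqrt e)%:C :> R[i] by rewrite ltcR sqrtr_gt0.
  have [z] := cF _ e0'; rewrite hof_ball ?sqrtr_gt0// => hz.
  exists (val z); first exact: valP.
  apply: (@filterS _ F) hz => x /=.
  by rewrite sqr_sqrtr ?ltW// /hof_quad hof_valB.
- apply/cvg_ex; exists (exist _ y Py).
  apply/cvg_ballP => e e0.
  have [r er] : exists r : R, e = r%:C.
    by apply/complex_realP; exact: gtr0_real.
  rewrite er in e0 *; rewrite ltcR in e0.
  rewrite near_simpl hof_ball//; have := hy (r ^+ 2); rewrite exprn_gt0// => /(_ isT).
  by apply: (@filterS _ F) => x /=; rewrite /hof_quad hof_valB.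
Qed.
HB.instance Definition _ := Uniform_isComplete.Build hilbert_of hof_complete.

Definition hof_inner : hilbert_of -> hilbert_of -> R[i] :=
  polar_inner hof_quad.

Fact hof_inner_herm x y : hof_inner x y = (-1) ^+ false * Num.conj (hof_inner y x).
Proof.
by rewrite expr0 mul1r; exact: (polar_inner_herm hof_quadZ hof_quad_par).
Qed.
Fact hof_inner_bilinear :
  bilinear_for *%R (Num.conj \; *%R) hof_inner.
Proof.
have L y : linear (hof_inner^~ y).
  exact: polar_inner_linear hof_quad_ge0 hof_quadZ hof_quad_par y.
split=> [//|x c y z].
rewrite !(hof_inner_herm x) expr0 !mul1r L rmorphD rmorphM /=.
by [].
Qed.
HB.instance Definition _ := bilinear_isBilinear.Build R[i] hilbert_of hilbert_of
  R[i] *%R (Num.conj \; *%R) hof_inner hof_inner_bilinear.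
HB.instance Definition _ := isHermitianSesquilinear.Build R[i] hilbert_of
  false Num.conj hof_inner hof_inner_herm.
Fact hof_inner_gt0 x : x != 0 -> 0 < hof_inner x x.
Proof.
move=> x0; rewrite [hof_inner x x]polar_inner_diag ?ltcR; last first.
- exact: hof_quad_par.
- exact: hof_quadZ.
rewrite lt_def hof_quad_ge0 andbT; apply: contra x0 => /eqP x0.
by apply/eqP/val_inj/(qnorm_eq0 (valP x)).
Qed.
HB.instance Definition _ := isDotProduct.Build R[i] hilbert_of hof_inner
  hof_inner_gt0.
Fact hof_inner_norm x : `|x| ^+ 2 = hof_inner x x.
Proof.
rewrite [hof_inner x x]polar_inner_diag; last first.
- exact: hof_quad_par.
- exact: hof_quadZ.
by rewrite hof_normE -rmorphXn /= sqr_sqrtr// hof_quad_ge0.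
Qed.
HB.instance Definition _ := CompleteNormedModule_isHilbert.Build R hilbert_of
  hof_inner_norm.

End HilbertOf.

(** * Inner products and the real-valued squared norm *)

Section InnerProduct.
Variables (R : realType) (H : hilbertType R).
Implicit Types (x y z : H) (c : R[i]).

Lemma innerC x y : inner x y = Num.conj (inner y x).
Proof. by rewrite [LHS]hermitian_subproof expr0 mul1r. Qed.
Lemma innerDl x y z : inner (x + y) z = inner x z + inner y z.
Proof. exact: linearDl. Qed.
Lemma innerZl c x z : inner (c *: x) z = c * inner x z.
Proof. exact: linearZl_LR. Qed.
Lemma innerDr x y z : inner z (x + y) = inner z x + inner z y.
Proof. by rewrite innerC innerDl rmorphD /= -!innerC. Qed.
Lemma innerZr c x z : inner z (c *: x) = Num.conj c * inner z x.
Proof. by rewrite innerC innerZl rmorphM /= -innerC. Qed.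
Lemma innerNl x z : inner (- x) z = - inner x z.
Proof. by rewrite -scaleN1r innerZl mulN1r. Qed.
Lemma innerNr x z : inner z (- x) = - inner z x.
Proof. by rewrite innerC innerNl rmorphN /= -innerC. Qed.
Lemma innerBl x y z : inner (x - y) z = inner x z - inner y z.
Proof. by rewrite innerDl innerNl. Qed.
Lemma innerBr x y z : inner z (x - y) = inner z x - inner z y.
Proof. by rewrite innerDr innerNr. Qed.
Lemma inner0l z : inner 0 z = 0.
Proof. by rewrite -(scale0r 0) innerZl mul0r. Qed.
Lemma inner0r z : inner z 0 = 0.
Proof. by rewrite innerC inner0l conjC0. Qed.
Lemma inner_suml (I : Type) (r : seq I) (F : I -> H) z :
  inner (\sum_(i <- r) F i) z = \sum_(i <- r) inner (F i) z.
Proof.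
elim: r => [|a r IH]; first by rewrite !big_nil inner0l.
by rewrite !big_cons innerDl IH.
Qed.
Lemma inner_sumr (I : Type) (r : seq I) (F : I -> H) z :
  inner z (\sum_(i <- r) F i) = \sum_(i <- r) inner z (F i).
Proof.
elim: r => [|a r IH]; first by rewrite !big_nil inner0r.
by rewrite !big_cons innerDr IH.
Qed.

Definition nsq x : R := Re (inner x x).

Lemma inner_nsq x : inner x x = (nsq x)%:C.
Proof.
have : 0 <= inner x x by rewrite -inner_norm exprn_ge0.
by move=> /ger0_Im h; apply: complex_ext.
Qed.
Lemma nsq_ge0 x : 0 <= nsq x.
Proof. by rewrite -lecR -inner_nsq -inner_norm exprn_ge0. Qed.
Lemma normr_nsq x : `|x| = (Num.sqrt (nsq x))%:C.
Proof.
apply/eqP; rewrite -(@eqrXn2 _ 2)// ?ler0c ?sqrtr_ge0//.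
by rewrite inner_norm inner_nsq -rmorphXn /= sqr_sqrtr ?nsq_ge0.
Qed.
Lemma nsq_eq0 x : nsq x = 0 -> x = 0.
Proof.
by move=> h; apply/eqP; rewrite -normr_eq0 normr_nsq h sqrtr0.
Qed.
Lemma nsqZ c x : nsq (c *: x) = normc2 c * nsq x.
Proof.
by rewrite /nsq innerZl innerZr mulrA mulcJ_normc2 inner_nsq -rmorphM.
Qed.
Lemma nsqN x : nsq (- x) = nsq x.
Proof. by rewrite /nsq innerNl innerNr opprK. Qed.
Lemma nsq0 : nsq 0 = 0.
Proof. by rewrite /nsq inner0l. Qed.
Lemma nsqD x y : nsq (x + y) = nsq x + nsq y + 2 * Re (inner x y).
Proof.
rewrite /nsq innerDl !innerDr !ReD (innerC y x) Re_conj; ring.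
Qed.
Lemma nsq_par x y : nsq (x + y) + nsq (x - y) = 2 * (nsq x + nsq y).
Proof. rewrite !nsqD nsqN innerNr ReN; ring. Qed.
Lemma nsqD_le x y : nsq (x + y) <= 2 * (nsq x + nsq y).
Proof. by have := nsq_ge0 (x - y); have := nsq_par x y; lra. Qed.

Lemma Im_inner x y : Im (inner x y) = Re (inner x ('i *: y)).
Proof.
rewrite innerZr ReM Re_conj Im_conj /=; lra.
Qed.

Lemma inner_CauchySchwarz x y : normc2 (inner x y) <= nsq x * nsq y.
Proof.
have pos a : 0 <= nsq x - 2 * a * normc2 (inner x y) + a ^+ 2 * normc2 (inner x y) *
  nsq y.
  have e : Re (inner x ((a%:C * inner x y) *: y)) = a * normc2 (inner x y).
    rewrite innerZr rmorphM /= -mulrA [X in _ * X]mulrC mulcJ_normc2.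
    by rewrite ReM Re_conj Im_conj /= oppr0 mul0r subr0.
  have := nsq_ge0 (x - (a%:C * inner x y) *: y).
  by rewrite nsqD nsqN nsqZ normc2M normc2R innerNr ReN e; lra.
have [ny|ny] := eqVneq (nsq y) 0.
  have -> : inner x y = 0 by rewrite (nsq_eq0 ny) inner0r.
  by rewrite normc2R expr0n ny mulr0.
have yp : 0 < nsq y by rewrite lt_def ny nsq_ge0.
have := mulr_ge0 (nsq_ge0 y) (pos (nsq y)^-1).
rewrite (_ : nsq y * _ = nsq x * nsq y - normc2 (inner x y)); last by field.
by rewrite subr_ge0.
Qed.

Lemma ball_nsq x (e : R) : 0 < e -> ball x e%:C = [set y | nsq (x - y) < e ^+ 2].
Proof.
move=> e0; rewrite -ball_normE; apply/seteqP; split=> y /=.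
all: rewrite normr_nsq ltcR => h.
  rewrite -[ltLHS]sqr_sqrtr ?nsq_ge0//.
  by rewrite ltr_pXn2r// nnegrE ?sqrtr_ge0// ltW.
by rewrite -(@ltr_pXn2r _ 2)// ?nnegrE ?sqrtr_ge0 ?sqr_sqrtr ?nsq_ge0// ltW.
Qed.

Lemma cvg_nsqP (T : Type) (F : set_system T) (FF : Filter F) (f : T -> H) y :
  f x @[x --> F] --> y <-> forall e : R, 0 < e -> F [set x | nsq (y - f x) < e].
Proof.
split=> [/cvg_ballP h e e0|h].
  have e0' : 0 < (Num.sqrt e)%:C :> R[i] by rewrite ltcR sqrtr_gt0.
  have := h _ e0'; rewrite near_simpl ball_nsq ?sqrtr_gt0//.
  by rewrite sqr_sqrtr// ltW.
apply/cvg_ballP => e e0.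
have [r er] : exists r : R, e = r%:C.
  by apply/complex_realP; exact: gtr0_real.
rewrite er in e0 *; rewrite ltcR in e0.
by rewrite near_simpl ball_nsq//; apply: h; rewrite exprn_gt0.
Qed.

Lemma nsq_complete (F : set_system H) : ProperFilter F ->
  (forall e : R, 0 < e -> exists z, F [set x | nsq (z - x) < e]) ->
  exists y, forall e : R, 0 < e -> F [set x | nsq (y - x) < e].
Proof.
move=> PF cF.
have /cauchy_cvg : cauchy F.
  apply: cauchy_exP => e e0.
  have [r er] : exists r : R, e = r%:C.
    by apply/complex_realP; exact: gtr0_real.
  rewrite er in e0 *; rewrite ltcR in e0.
  have [|z hz] := cF (r ^+ 2); first by rewrite exprn_gt0.
  by exists z; rewrite ball_nsq.
by move=> /cvg_ex [y hy]; exists y => e e0; move/cvg_nsqP : hy; apply.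
Qed.

End InnerProduct.

(** * Unitary representations from isometric actions *)

Section UnitaryFromNorm.
Variables (R : realType) (H : hilbertType R) (U : H -> H).

(** Polarisation: [nsqD] gives the real parts, and ['i *: y] in place of [y] the imaginary ones. *)
Lemma inner_preserved : linear U -> (forall x, nsq (U x) = nsq x) ->
  forall x y, inner (U x) (U y) = inner x y.
Proof.
move=> Ul Un.
have UD x y : U (x + y) = U x + U y by rewrite -[x]scale1r Ul !scale1r.
have UZ c x : U (c *: x) = c *: U x.
  have U0 : U 0 = 0.
    by have /eqP := UD 0 0; rewrite addr0 -subr_eq subrr eq_sym => /eqP.
  by rewrite -[c *: x]addr0 Ul U0 addr0.
have rin x y : Re (inner (U x) (U y)) = Re (inner x y).
  by have := Un (x + y); rewrite UD !nsqD !Un; lra.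
move=> x y; apply: complex_ext; first exact: rin.
by rewrite !Im_inner -UZ rin.
Qed.

End UnitaryFromNorm.

(** Continuity at [1%g] suffices: the action is isometric, so [|g0 x - g x| = |x - g0^-1 g x|]. *)
Record quad_action (R : realType) (G : topologicalGroupType)
    (V : lmodType R[i]) (D : quadspace V) := QuadAction {
  qact : G -> V -> V ;
  qact_linear : forall g, linear (qact g) ;
  qact_mem : forall g x, qmem D x -> qmem D (qact g x) ;
  qact_norm : forall g x, qmem D x -> qnorm D (qact g x) = qnorm D x ;
  qact1 : forall x, qact 1%g x = x ;
  qactM : forall g h x, qact (g * h)%g x = qact g (qact h x) ;
  qact_cont : forall x, qmem D x -> forall e : R, 0 < e ->
    nbhs (1%g : G) [set g | qnorm D (x - qact g x) < e]
}.

Section RepOfAction.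
Variables (R : realType) (G : topologicalGroupType) (V : lmodType R[i]).
Variables (D : quadspace V) (A : quad_action G D).

Definition rep_of_action (g : G) (x : hilbert_of D) : hilbert_of D :=
  exist _ (qact A g (val x)) (qact_mem A g (valP x)).

Lemma nsq_hof (x : hilbert_of D) : nsq x = qnorm D (val x).
Proof.
by rewrite /nsq [inner x x]polar_inner_diag//; [exact: hof_quadZ|exact: hof_quad_par].
Qed.

Lemma rep_of_action_unitary : unitary_rep rep_of_action.
Proof.
split=> [g|x|g h x]; [|by apply: val_inj; rewrite /= qact1
                      |by apply: val_inj; rewrite /= qactM].
have l : linear (rep_of_action g).
  by move=> c x y; apply: val_inj; rewrite /= qact_linear.
split=> //.
  by apply: inner_preserved => // x; rewrite !nsq_hof /= qact_norm// (valP x).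
move=> x; exists (rep_of_action g^-1%g x); apply: val_inj.
by rewrite /= -qactM mulgV qact1.
Qed.

Lemma rep_of_action_continuous : strongly_continuous rep_of_action.
Proof.
move=> x g0; apply/cvg_nsqP => e e0.
have c : (g0^-1 * g)%g @[g --> g0] --> (1%g : G).
  rewrite -(mulVg g0).
  apply: (@cvg_comp _ _ _ (fun g : G => (g0^-1%g, g))
            (fun p : G * G => (p.1 * p.2)%g) _ (nbhs (g0^-1%g, g0))).
    by apply: cvg_pair => //=; exact: cvg_cst.
  exact: (mulg_continuous (g0^-1%g, g0)).
have h : nbhs g0 ((fun g : G => (g0^-1 * g)%g) @^-1`
    [set g | qnorm D (val x - qact A g (val x)) < e]) := c _ (qact_cont A (valP x) e0).
apply: filterS h => g /=.
have mB y z : qmem D y -> qmem D z -> qmem D (y - z).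
  by move=> my mz; rewrite -scaleN1r qmemD// qmemZ.
have mg := qact_mem A (g0^-1 * g)%g (valP x).
rewrite nsq_hof hof_valB /= -(qact_norm A g0) ?mB ?(valP x)//.
have -> : val x - qact A (g0^-1 * g)%g (val x) =
    (-1) *: qact A (g0^-1 * g)%g (val x) + val x by rewrite scaleN1r addrC.
by rewrite qact_linear -qactM mulgA mulgV mul1g scaleN1r addrC.
Qed.

End RepOfAction.

(** * Orthonormal families and closed subspaces *)

Section GramSchmidt.
Variables (R : realType) (H : hilbertType R).
Implicit Types (x y e : H) (es : seq H).

Fixpoint orthonormal es : Prop :=
  if es is e :: es' then
    [/\ nsq e = 1, forall f, f \in es' -> inner e f = 0 & orthonormal es']
  else True.

Definition proj es x : H := \sum_(e <- es) inner x e *: e.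

Lemma inner_proj es x f : orthonormal es -> f \in es ->
  inner (proj es x) f = inner x f.
Proof.
rewrite /proj; elim: es => // e es IH [e1 eorth oes].
rewrite in_cons big_cons innerDl innerZl => /orP[/eqP->|fes].
  rewrite inner_nsq e1 mulr1 inner_suml big_seq big1 ?addr0// => i ies.
  by rewrite innerZl (innerC i) eorth// conjC0 mulr0.
by rewrite eorth// mulr0 add0r IH.
Qed.

Lemma proj_residual_orthogonal es x f : orthonormal es -> f \in es ->
  inner (x - proj es x) f = 0.
Proof. by move=> oes fes; rewrite innerBl inner_proj// subrr. Qed.

Lemma orthonormal_extend es x : orthonormal es -> proj es x != x ->
  let e := ((Num.sqrt (nsq (x - proj es x)))^-1)%:C *: (x - proj es x) in
  orthonormal (e :: es) /\ proj (e :: es) x = x.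
Proof.
move=> oes px e; set z := x - proj es x in e *.
have z0 : z != 0 by rewrite subr_eq0 eq_sym.
have nz : 0 < nsq z.
  rewrite lt_def nsq_ge0 andbT; apply: contra z0 => /eqP h.
  by apply/eqP; exact: nsq_eq0.
have n1 : nsq e = 1.
  by rewrite nsqZ normc2R exprVn sqr_sqrtr ?nsq_ge0// mulVf// gt_eqF.
have zf f : f \in es -> inner z f = 0 by exact: proj_residual_orthogonal.
split.
  by split=> // f fes; rewrite [LHS]innerZl (zf _ fes) mulr0.
rewrite /proj big_cons -/(proj es x).
have zp : inner (proj es x) z = 0.
  rewrite /proj inner_suml big_seq big1// => f fes.
  by rewrite innerZl (innerC f) zf// conjC0 mulr0.
have -> : inner x e = (Num.sqrt (nsq z))%:C.
  have -> : x = z + proj es x by rewrite subrK.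
  rewrite innerZr innerDl zp addr0 inner_nsq conjCE /= oppr0 -/(_%:C) -rmorphM /=.
  congr (_%:C); rewrite -[X in _ * X]sqr_sqrtr ?nsq_ge0//.
  by rewrite expr2 mulrA mulVf ?mul1r// gt_eqF// sqrtr_gt0.
rewrite scalerA -rmorphM /= mulfV ?scale1r ?subrK//.
by rewrite gt_eqF// sqrtr_gt0.
Qed.

Lemma proj_extend es e y : orthonormal (e :: es) -> proj es y = y ->
  proj (e :: es) y = y.
Proof.
move=> [_ eorth oes] py.
have ye : inner y e = 0.
  rewrite -py /proj inner_suml big_seq big1// => f fes.
  by rewrite innerZl (innerC f) eorth// conjC0 mulr0.
by rewrite /proj big_cons -/(proj es y) ye scale0r add0r.
Qed.

Lemma gram_schmidt (xs : seq H) :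
  exists2 es, orthonormal es & forall x, x \in xs -> proj es x = x.
Proof.
elim: xs => [|x xs [es oes h]]; first by exists [::].
have [px|px] := eqVneq (proj es x) x.
  by exists es => // y; rewrite in_cons => /orP[/eqP->|/h].
have [oes' pes] := orthonormal_extend oes px.
eexists; first exact: oes'.
move=> y; rewrite in_cons => /orP[/eqP->|/h py]; first exact: pes.
exact: proj_extend.
Qed.

Lemma inner_projE es x y : proj es x = x ->
  inner x y = \sum_(e <- es) inner x e * Num.conj (inner y e).
Proof.
move=> {1}<-; rewrite /proj inner_suml; apply: eq_bigr => e _.
by rewrite innerZl (innerC e).
Qed.

End GramSchmidt.

(** * Closed invariant subspaces *)

Section ClosedSubspace.
Variables (R : realType) (H : hilbertType R) (P : H -> Prop).

Record closed_subspace : Prop := ClosedSubspace {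
  csub0 : P 0 ;
  csubD : forall x y, P x -> P y -> P (x + y) ;
  csubZ : forall c x, P x -> P (c *: x) ;
  csub_closed : forall x,
    (forall e : R, 0 < e -> exists2 y, P y & nsq (x - y) < e) -> P x
}.

Hypothesis hP : closed_subspace.

Definition subspace_quad : quadspace H.
Proof.
refine (@QuadSpace R H (fun x => `[<P x>]) (@nsq R H) _ _ _ _ _ _ _ _).
- by apply/asboolP; exact: csub0.
- by move=> x y /asboolP Px /asboolP Py; apply/asboolP; exact: csubD.
- by move=> c x /asboolP Px; apply/asboolP; exact: csubZ.
- by move=> x _; exact: nsq_ge0.
- by move=> x _; exact: nsq_eq0.
- by move=> c x _; exact: nsqZ.
- by move=> x y _ _; rewrite nsq_par.
- move=> F PF FP cF; have [|y hy] := nsq_complete PF.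
    by move=> e /cF [z _ hz]; exists z.
  exists y => //; apply/asboolP/(csub_closed hP) => e /hy hye.
  by have [z [Fz /asboolP Pz]] := filter_ex (filterI hye FP); exists z.
Defined.

Variables (G : topologicalGroupType) (pi : G -> H -> H).
Hypotheses (pi_rep : unitary_rep pi) (pi_cont : strongly_continuous pi).

Lemma rep_nsq g x : nsq (pi g x) = nsq x.
Proof. by rewrite /nsq (unitary_inner (rep_unitary pi_rep g)). Qed.

Lemma rep_linear g : linear (pi g).
Proof. exact: (unitary_linear (rep_unitary pi_rep g)). Qed.

Lemma repD g x y : pi g (x + y) = pi g x + pi g y.
Proof. by have := rep_linear g 1 x y; rewrite !scale1r. Qed.

Lemma rep0 g : pi g 0 = 0.
Proof. by apply: nsq_eq0; rewrite rep_nsq nsq0. Qed.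

Lemma repZ g c x : pi g (c *: x) = c *: pi g x.
Proof. by have := rep_linear g c x 0; rewrite rep0 !addr0. Qed.

Lemma repB g x y : pi g (x - y) = pi g x - pi g y.
Proof. by rewrite -scaleN1r repD repZ scaleN1r. Qed.

Lemma repK g x : pi g^-1%g (pi g x) = x.
Proof. by rewrite -(repM pi_rep) mulVg (rep1 pi_rep). Qed.

Lemma repVK g x : pi g (pi g^-1%g x) = x.
Proof. by rewrite -(repM pi_rep) mulgV (rep1 pi_rep). Qed.

Lemma inner_repl g x y : inner (pi g x) y = inner x (pi g^-1%g y).
Proof.
by rewrite -[in RHS](unitary_inner (rep_unitary pi_rep g)) repVK.
Qed.

Lemma rep_nbhs1 x (e : R) : 0 < e ->
  nbhs (1%g : G) [set g | nsq (x - pi g x) < e].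
Proof.
move=> e0; have /cvg_nsqP /(_ e e0) := pi_cont (u := x) (x := 1%g).
by rewrite (rep1 pi_rep).
Qed.

Hypothesis P_inv : forall g x, P x -> P (pi g x).

Definition subrep_action : quad_action G subspace_quad.
Proof.
refine (@QuadAction R G H subspace_quad pi _ _ _ _ _ _).
- exact: rep_linear.
- by move=> g x /asboolP Px; apply/asboolP; exact: P_inv.
- by move=> g x _; exact: rep_nsq.
- exact: (rep1 pi_rep).
- exact: (repM pi_rep).
- by move=> x _ e e0; exact: rep_nbhs1.
Defined.

(** An orthonormal family of maximal size in [P] spans it: the normalised residual of a vector
    outside its span would extend it. *)
Lemma finite_dimensional_subspace (B : nat) :
  (forall es, orthonormal es -> (forall e, e \in es -> P e) -> (size es <= B)%N) ->
  finite_dimensional (hilbert_of subspace_quad).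
Proof.
move=> hB.
pose A n := `[<exists es, [/\ orthonormal es, forall e, e \in es -> P e & size es =
  n]>].
have exA : exists n, A n by exists 0%N; apply/asboolP; exists [::].
have leA n : A n -> (n <= B)%N by move=> /asboolP [es [oes pes <-]]; exact: hB.
case: (ex_maxnP exA leA) => n /asboolP [es [oes Pes <-]] maxn.
have span x : P x -> proj es x = x.
  move=> Px; apply/eqP/negP => /negP px.
  have [oes' _] := orthonormal_extend oes px.
  have : A (size es).+1.
    apply/asboolP; eexists; split; [exact: oes'| |by []].
    move=> e; rewrite in_cons => /orP[/eqP->|/Pes//].
    apply: csubZ => //; rewrite -scaleN1r; apply: (csubD hP) => //.
    apply: (csubZ hP); rewrite /proj big_seq.
    apply: big_ind => [|y z|i ies]; [exact: csub0|exact: csubD|].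
    by apply: csubZ => //; exact: Pes.
  by move/maxn; rewrite ltnn.
have nthP (i : 'I_(size es)) : `[<P (es`_i)>].
  by apply/asboolP/Pes; rewrite mem_nth.
exists (size es), (fun i : 'I_(size es) => exist _ es`_i (nthP i) :
  hilbert_of subspace_quad) => u.
exists (fun i => inner (val u) es`_i); apply: val_inj.
have /asboolP Pu := valP u.
rewrite -[LHS](span _ Pu) /proj (big_nth 0) big_mkord.
by rewrite (big_morph (fun v : hilbert_of subspace_quad => val v)
  (id1 := 0) (op1 := +%R)).
Qed.

End ClosedSubspace.

(** The subspace is the orthogonal complement of the invariant vectors. An invariant vector in it is
    orthogonal to itself; and it contains every [pi g u - u], one of which is nonzero. *)
Lemma rep_without_invariant_vectors (R : realType) (G : topologicalGroupType) :
  has_nontrivial_unitary_rep R G ->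
  exists (H : hilbertType R) (pi : G -> H -> H),
    [/\ unitary_rep pi, strongly_continuous pi,
      (forall x, (forall g, pi g x = x) -> x = 0) & exists x : H, x != 0].
Proof.
move=> [H [pi [pr pc pn]]].
pose P (x : H) := forall z, (forall g, pi g z = z) -> inner x z = 0.
have hP : closed_subspace P.
  split.
  - by move=> z _; rewrite inner0l.
  - by move=> x y Px Py z hz; rewrite innerDl Px// Py// addr0.
  - by move=> c x Px z hz; rewrite innerZl Px// mulr0.
  - move=> x hx z hz; apply: normc2_eq0; apply/eqP.
    rewrite eq_le normc2_ge0 andbT; apply/ler_addgt0Pr => e e0; rewrite add0r.
    have [|y Py xy] := hx (e / (nsq z + 1)).
      by rewrite divr_gt0// ltr_wpDl ?nsq_ge0.
    have -> : inner x z = inner (x - y) z by rewrite innerBl Py// subr0.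
    apply: le_trans (inner_CauchySchwarz _ _) _.
    have zp : 0 < nsq z + 1 by rewrite ltr_wpDl ?nsq_ge0.
    move: xy; rewrite ltr_pdivlMr// => xy; apply: le_trans _ (ltW xy).
    by rewrite ler_wpM2l ?nsq_ge0// lerDl.
have Pinv g x : P x -> P (pi g x).
  by move=> Px z hz; rewrite (inner_repl pr) hz Px.
pose A := subrep_action hP pr pc Pinv.
exists (hilbert_of (subspace_quad hP)), (rep_of_action A); split.
- exact: rep_of_action_unitary.
- exact: rep_of_action_continuous.
- move=> x hx; apply: val_inj; apply: nsq_eq0.
  have /asboolP Px := valP x.
  rewrite /nsq Px// => g; exact: (congr1 val (hx g)).
- have [g [u gu]] : exists g u, pi g u <> u.
    apply: contrapT => h; apply: pn => g u; apply: contrapT => h'.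
    by apply: h; exists g, u.
  have Px : `[<P (pi g u - u)>].
    apply/asboolP => z hz; rewrite innerBl -{1}(hz g).
    by rewrite (unitary_inner (rep_unitary pr g)) subrr.
  exists (exist (fun x => qmem (subspace_quad hP) x) _ Px :
    hilbert_of (subspace_quad hP)).
  apply/negP => /eqP /(congr1 val) /= /eqP; rewrite subr_eq0 => /eqP.
  exact: gu.
Qed.

(** * Reproducing kernel spaces *)

Lemma eq_ler (R : numDomainType) (x y : R) : x = y -> x <= y.
Proof. by move=> ->. Qed.

Section ReproducingKernel.
Variables (R : realType) (I : Type) (k : I -> I -> R).
Implicit Types (f g : I -> R[i]) (v w : seq (R[i] * I)) (c : R[i]).

(** A list stands for a formal combination, with concatenation as sum. In the space built below,
    [lincomb f v] is [Re <f, kernel_comb v>], and [gram] is the real part of the inner product of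
    kernel combinations. *)
Definition lincomb f v : R := \sum_(a <- v) Re (a.1 * f a.2).
Definition gram v w : R :=
  \sum_(a <- v) \sum_(b <- w) Re (a.1 * Num.conj b.1) * k a.2 b.2.
Definition scale_comb c v : seq (R[i] * I) := [seq (c * a.1, a.2) | a <- v].

Hypothesis k_sym : forall i j, k i j = k j i.
Hypothesis gram_ge0 : forall v, 0 <= gram v v.

Lemma lincomb_cat f v w : lincomb f (v ++ w) = lincomb f v + lincomb f w.
Proof. by rewrite /lincomb big_cat. Qed.
Lemma lincombD f g v : lincomb (f + g) v = lincomb f v + lincomb g v.
Proof.
by rewrite /lincomb -big_split; apply: eq_bigr => a _ /=; rewrite mulrDr ReD.
Qed.
Lemma lincombZ c f v : lincomb (c *: f) v = lincomb f (scale_comb c v).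
Proof.
rewrite /lincomb /scale_comb big_map; apply: eq_bigr => a _ /=.
by rewrite [(c *: f) _]/(c * f a.2) mulrA (mulrC a.1).
Qed.
Lemma lincombN f v : lincomb (- f) v = - lincomb f v.
Proof.
rewrite /lincomb -sumrN; apply: eq_bigr => a _.
by rewrite [(- f) _]/(- f a.2) mulrN ReN.
Qed.
Lemma lincombB f g v : lincomb (f - g) v = lincomb f v - lincomb g v.
Proof. by rewrite lincombD lincombN. Qed.
Lemma lincomb_scaleR (t : R) f v :
  lincomb f (scale_comb t%:C v) = t * lincomb f v.
Proof.
rewrite /lincomb /scale_comb big_map mulr_sumr; apply: eq_bigr => a _ /=.
by rewrite -mulrA ReM /= mul0r subr0.
Qed.
Lemma lincomb0 v : lincomb 0 v = 0.
Proof. by rewrite /lincomb big1// => a _; rewrite [0 a.2]/0 mulr0. Qed.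

Lemma gramC v w : gram v w = gram w v.
Proof.
rewrite /gram exchange_big; apply: eq_bigr => a _; apply: eq_bigr => b _.
rewrite k_sym; congr (_ * _); rewrite !ReM !Re_conj !Im_conj; ring.
Qed.
Lemma gram_catl v v' w : gram (v ++ v') w = gram v w + gram v' w.
Proof. by rewrite /gram big_cat. Qed.
Lemma gram_catr v v' w : gram w (v ++ v') = gram w v + gram w v'.
Proof. by rewrite gramC gram_catl !(gramC w). Qed.
Lemma gram_scaleRl (t : R) v w : gram (scale_comb t%:C v) w = t * gram v w.
Proof.
rewrite /gram /scale_comb big_map mulr_sumr; apply: eq_bigr => a _ /=.
rewrite mulr_sumr; apply: eq_bigr => b _; rewrite mulrA; congr (_ * _).
by rewrite -mulrA ReM /= mul0r subr0.
Qed.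
Lemma gram_scaleRr (t : R) v w : gram w (scale_comb t%:C v) = t * gram w v.
Proof. by rewrite gramC gram_scaleRl gramC. Qed.
Lemma gram_scale c v : gram (scale_comb c v) (scale_comb c v) = normc2 c * gram v v.
Proof.
rewrite /gram /scale_comb big_map mulr_sumr; apply: eq_bigr => a _ /=.
rewrite big_map mulr_sumr; apply: eq_bigr => b _ /=; rewrite mulrA; congr (_ * _).
rewrite /normc2 !ReM !Re_conj !Im_conj !ReM !ImM; ring.
Qed.

(** The squared norm is defined as a Legendre transform: [|f|^2] is the supremum over [v] of
    [2 Re <f, k_v> - |k_v|^2], with [k_v] the kernel combination of [v]. This gives the reproducing
    kernel space without a quotient or a completion. *)
Definition rk_values f : set R := [set 2 * lincomb f v - gram v v | v in setT].
Definition rk_mem f : Prop := has_ubound (rk_values f).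
Definition rk_norm f : R := sup (rk_values f).

Lemma rk_memP f (B : R) : (forall v, 2 * lincomb f v - gram v v <= B) -> rk_mem f.
Proof. by move=> h; exists B => _ [v _ <-]. Qed.

Lemma rk_norm_ub f v : rk_mem f -> 2 * lincomb f v - gram v v <= rk_norm f.
Proof. by move=> hf; apply: ub_le_sup => //; exists v. Qed.

Lemma rk_norm_le f (B : R) :
  (forall v, 2 * lincomb f v - gram v v <= B) -> rk_norm f <= B.
Proof.
move=> h; apply: ge_sup; last by move=> _ [v _ <-].
by exists (2 * lincomb f [::] - gram [::] [::]), [::].
Qed.

Lemma rk_norm_ge0 f : rk_mem f -> 0 <= rk_norm f.
Proof.
by move=> /(rk_norm_ub [::]); rewrite /lincomb /gram !big_nil mulr0 subr0.
Qed.

Lemma rk_mem0 : rk_mem 0.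
Proof.
by apply: (@rk_memP _ 0) => v; rewrite lincomb0 mulr0 sub0r oppr_le0.
Qed.

(** The norm of [f] is tested at [(v + w) / 2] and that of [g] at [(v - w) / 2]; the parallelogram
    law for [gram] does the rest. *)
Lemma rk_par_bound f g v w : rk_mem f -> rk_mem g ->
  (2 * lincomb (f + g) v - gram v v) + (2 * lincomb (f - g) w - gram w w) <=
  2 * (rk_norm f + rk_norm g).
Proof.
move=> hf hg.
have := rk_norm_ub (scale_comb (2^-1)%:C (v ++ w)) hf.
have := rk_norm_ub (scale_comb (2^-1)%:C (v ++ scale_comb (-1)%:C w)) hg.
rewrite !lincomb_scaleR !lincomb_cat !lincomb_scaleR !gram_scaleRl !gram_scaleRr.
rewrite !gram_catl !gram_catr !gram_scaleRl !gram_scaleRr (gramC w v).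
rewrite lincombD lincombB; lra.
Qed.

Lemma rk_memD f g : rk_mem f -> rk_mem g -> rk_mem (f + g).
Proof.
move=> hf hg; apply: (@rk_memP _ (2 * (rk_norm f + rk_norm g))) => v.
have := rk_par_bound v [::] hf hg.
by rewrite {2}/lincomb {2}/gram !big_nil mulr0 subr0 addr0.
Qed.

Lemma rk_scale_bound c f v : c != 0 -> rk_mem f ->
  2 * lincomb (c *: f) v - gram v v <= normc2 c * rk_norm f.
Proof.
move=> c0 hf; have n0 : 0 < normc2 c.
  rewrite lt_def normc2_ge0 andbT; apply: contra c0 => /eqP h.
  by apply/eqP; exact: normc2_eq0.
(* The value of [c *: f] at [v] is [normc2 c] times the value of [f] at [c v / |c|^2]. *)
have := rk_norm_ub (scale_comb ((normc2 c)^-1)%:C (scale_comb c v)) hf.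
rewrite lincomb_scaleR -lincombZ gram_scale normc2R gram_scale.
rewrite -(ler_pM2l n0); apply: le_trans; apply: eq_ler; field.
by rewrite gt_eqF.
Qed.

Lemma rk_memZ c f : rk_mem f -> rk_mem (c *: f).
Proof.
have [->|c0] := eqVneq c 0; first by rewrite scale0r => _; exact: rk_mem0.
by move=> hf; apply: rk_memP => v; exact: rk_scale_bound.
Qed.

Lemma rk_norm0 : rk_norm 0 = 0.
Proof.
apply/le_anti; rewrite (rk_norm_ge0 rk_mem0) andbT; apply: rk_norm_le => v.
by rewrite lincomb0 mulr0 sub0r oppr_le0.
Qed.

Lemma rk_normZ c f : rk_mem f -> rk_norm (c *: f) = normc2 c * rk_norm f.
Proof.
move=> hf; have [->|c0] := eqVneq c 0.
  by rewrite scale0r rk_norm0 normc2R expr0n mul0r.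
have le c' g : c' != 0 -> rk_mem g -> rk_norm (c' *: g) <= normc2 c' * rk_norm g.
  by move=> c'0 hg; apply: rk_norm_le => v; exact: rk_scale_bound.
apply/le_anti; rewrite le//=.
have := le c^-1 (c *: f); rewrite invr_eq0 c0 => /(_ isT (rk_memZ c hf)).
rewrite scalerA mulVf// scale1r => /(ler_wpM2l (normc2_ge0 c)).
by rewrite mulrA -normc2M mulfV// normc2R expr1n mul1r.
Qed.

Lemma rk_par f g : rk_mem f -> rk_mem g ->
  rk_norm (f + g) + rk_norm (f - g) <= 2 * (rk_norm f + rk_norm g).
Proof.
move=> hf hg; rewrite -lerBrDr; apply: rk_norm_le => v.
rewrite lerBrDr addrC -lerBrDr; apply: rk_norm_le => w.
by rewrite lerBrDr addrC; exact: rk_par_bound.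
Qed.

Lemma rk_memB f g : rk_mem f -> rk_mem g -> rk_mem (f - g).
Proof. by move=> hf hg; rewrite -scaleN1r; apply: rk_memD => //; exact: rk_memZ. Qed.

Lemma rk_normD_le f g : rk_mem f -> rk_mem g ->
  rk_norm (f + g) <= 2 * (rk_norm f + rk_norm g).
Proof.
move=> hf hg; apply: le_trans (rk_par hf hg).
by rewrite lerDl rk_norm_ge0//; exact: rk_memB.
Qed.

Lemma kernel_ge0 i : 0 <= k i i.
Proof.
have := gram_ge0 [:: (1, i)].
by rewrite /gram !big_seq1 mulcJ_normc2 /normc2 /= expr0n expr1n addr0 mul1r.
Qed.

(** The test combinations are [t conj (f i)] at the point [i]. The best [t] is [1 / k i i]; if
    [k i i = 0], a large [t] forces [f i = 0]. *)
Lemma rk_eval f i : rk_mem f -> normc2 (f i) <= rk_norm f * k i i.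
Proof.
move=> hf; have N0 := rk_norm_ge0 hf.
have k0 := kernel_ge0 i.
have h t : 2 * (t * normc2 (f i)) - t ^+ 2 * normc2 (f i) * k i i <= rk_norm f.
  have := rk_norm_ub [:: (t%:C * Num.conj (f i), i)] hf.
  rewrite /lincomb /gram !big_seq1 /= mulcJ_normc2 normc2M normc2R normc2_conj /=.
  by rewrite -mulrA (mulrC (Num.conj _)) mulcJ_normc2 -rmorphM.
have n0 := normc2_ge0 (f i).
have [kz|kn] := eqVneq (k i i) 0.
  rewrite kz mulr0 leNgt; apply/negP => p.
  have := h ((rk_norm f + 1) / normc2 (f i)).
  by rewrite kz mulr0 subr0 divfK ?gt_eqF//; lra.
have kp : 0 < k i i by rewrite lt_def kn.
rewrite -ler_pdivrMr//; apply: le_trans (h (k i i)^-1).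
by apply: eq_ler; field.
Qed.

Lemma rk_norm_eq0 f : rk_mem f -> rk_norm f = 0 -> f = 0.
Proof.
move=> hf f0; apply/funext => i; apply: normc2_eq0; apply/le_anti.
by rewrite normc2_ge0 andbT; have := rk_eval i hf; rewrite f0 mul0r.
Qed.

(** The norm controls point values, so a Cauchy filter converges pointwise to some [l]. For fixed
    [v] the expression under the supremum is continuous for pointwise convergence, so the norm is
    lower semicontinuous and the Cauchy estimates pass to [l]. *)
Lemma rk_complete (F : set_system (I -> R[i])) : ProperFilter F -> F rk_mem ->
  (forall e : R, 0 < e -> exists2 z, rk_mem z & F [set x | rk_norm (z - x) < e]) ->
  exists2 y, rk_mem y & forall e : R, 0 < e -> F [set x | rk_norm (y - x) < e].
Proof.
move=> PF Fm cF.
have part (p : R[i] -> R) i : (forall c d, p (c - d) = p c - p d) ->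
    (forall c, p c ^+ 2 <= normc2 c) ->
    exists l : R, forall e, 0 < e -> F [set x : I -> R[i] | `|l - p (x i)| < e].
  move=> pB ple.
  have : cauchy ((fun x : I -> R[i] => p (x i)) @ F).
    apply: cauchy_exP => e e0.
    have k1 : 0 < k i i + 1 by rewrite ltr_wpDl// kernel_ge0.
    have [|z mz hz] := cF (e ^+ 2 / (k i i + 1)); first by rewrite divr_gt0 ?exprn_gt0.
    exists (p (z i)); rewrite -ball_normE.
    change (F [set x : I -> R[i] | `|p (z i) - p (x i)| < e]).
    apply: filterS (filterI hz Fm) => x [/= xz mx].
    have mzx := rk_memB mz mx.
    rewrite -pB -(@ltr_pXn2r _ 2)// ?nnegrE ?(ltW e0)// real_normK ?num_real//.
    apply: (le_lt_trans (ple _)); apply: (le_lt_trans (rk_eval i mzx)).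
    move: xz; rewrite ltr_pdivlMr//; apply: le_lt_trans.
    by rewrite ler_wpM2l ?rk_norm_ge0// lerDl.
  move=> /cauchy_cvg/cvg_ex [l /cvgrPdist_lt hl]; exists l => e e0; exact: hl.
have hex (i : I) : exists c : R[i], forall e, 0 < e ->
    F [set x : I -> R[i] | `|Re c - Re (x i)| < e /\ `|Im c - Im (x i)| < e].
  have [||a ha] := part (@Re R) i.
  - by move=> c d; rewrite ReD ReN.
  - by move=> c; rewrite lerDl sqr_ge0.
  have [||b hb] := part (@Im R) i.
  - by move=> c d; rewrite ImD ImN.
  - by move=> c; rewrite lerDr sqr_ge0.
  by exists (a +i* b) => e e0; exact: filterI (ha e e0) (hb e e0).
have [l hl] := choice hex.
have ev_lim v e : 0 < e -> F [set x | `|lincomb (l - x) v| < e].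
  elim: v e => [|[c i] v IH] e e0.
    by apply: filterS filterT => x _ /=; rewrite /lincomb big_nil normr0.
  pose M := `|Re c| + `|Im c| + 1.
  have M0 : 0 < M by rewrite ltr_wpDl// addr_ge0.
  have [e2 eM] : 0 < e / 2 /\ 0 < e / 2 / M by rewrite !divr_gt0.
  apply: filterS (filterI (IH _ e2) (hl i _ eM)) => x /= [h1 [h2 h3]].
  rewrite /lincomb big_cons -/(lincomb _ v) /=.
  rewrite (le_lt_trans (ler_normD _ _))// [ltRHS]splitr ltrD//.
  rewrite [(l - x) i]/(l i - x i) ReM ReD ImD ReN ImN.
  rewrite (le_lt_trans (ler_normB _ _))// !normrM.
  have -> : e / 2 = e / 2 / M * M by rewrite divfK// gt_eqF.
  have := ler_wpM2l (normr_ge0 (Re c)) (ltW h2).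
  have := ler_wpM2l (normr_ge0 (Im c)) (ltW h3).
  rewrite /M; move: eM; rewrite /M; set t := e / 2 / _; lra.
have key e : 0 < e -> F [set x | [/\ rk_mem x, rk_mem (l - x) & rk_norm (l - x) < e]].
  (* The triangle inequality for squared norms costs a factor [2]: [2 (e / 8 + e / 8) = e / 2]. *)
  move=> e0; have [|z mz hz] := cF (e / 8); first by rewrite divr_gt0.
  apply: filterS (filterI hz Fm) => x [/= xz mx].
  have bnd v : 2 * lincomb (l - x) v - gram v v <= e / 2.
    apply/ler_addgt0Pr => d d0; have d2 : 0 < d / 2 by rewrite divr_gt0.
    have [x' [/= lx' [/= x'z mx']]] :=
      filter_ex (filterI (ev_lim v _ d2) (filterI hz Fm)).
    have zx' := rk_memB mz mx'; have zx := rk_memB mz mx.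
    have x'x := rk_memB mx' mx.
    have := rk_norm_ub v x'x.
    have := rk_normD_le zx (rk_memZ (-1) zx').
    rewrite rk_normZ// normc2N normc2R expr1n mul1r scaleN1r opprB.
    rewrite (_ : z - x + (x' - z) = x' - x); last by rewrite addrC addrA subrK.
    have := ltr_normlW lx'.
    by rewrite !lincombB; lra.
  split=> //; first exact: rk_memP bnd.
  by apply: le_lt_trans (rk_norm_le bnd) _; lra.
exists l => [|e e0]; last by apply: filterS (key e e0) => x [].
have [x [mx mlx _]] := filter_ex (key 1 ltr01).
by rewrite -(subrK x l); exact: rk_memD.
Qed.

Definition rk_quad : quadspace (I -> R[i]).
Proof.
refine (@QuadSpace R _ (fun f => `[<rk_mem f>]) rk_norm _ _ _ _ _ _ _ _).
- by apply/asboolP; exact: rk_mem0.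
- by move=> x y /asboolP Px /asboolP Py; apply/asboolP; exact: rk_memD.
- by move=> c x /asboolP Px; apply/asboolP; exact: rk_memZ.
- by move=> x /asboolP; exact: rk_norm_ge0.
- by move=> x /asboolP; exact: rk_norm_eq0.
- by move=> c x /asboolP; exact: rk_normZ.
- by move=> x y /asboolP hx /asboolP; exact: rk_par.
- move=> F PF FP cF.
  have FP' : F rk_mem by apply: filterS FP => x /asboolP.
  have [|y my hy] := rk_complete PF FP'.
    by move=> e /cF [z /asboolP mz hz]; exists z.
  by exists y => //; apply/asboolP.
Defined.

Definition kernel_comb v : I -> R[i] :=
  fun j => \sum_(a <- v) Num.conj a.1 * (k a.2 j)%:C.

Lemma lincomb_kernel v w : lincomb (kernel_comb v) w = gram w v.
Proof.
rewrite /lincomb /gram; apply: eq_bigr => a _; rewrite /kernel_comb mulr_sumr.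
rewrite (big_morph _ (@ReD R) (erefl : Re (0 : R[i]) = 0)); apply: eq_bigr => b _.
by rewrite mulrA ReMr k_sym.
Qed.

Lemma kernel_comb_bound v w :
  2 * lincomb (kernel_comb v) w - gram w w <= gram v v.
Proof.
have := gram_ge0 (w ++ scale_comb (-1)%:C v); rewrite lincomb_kernel.
rewrite !gram_catl !gram_catr !gram_scaleRl !gram_scaleRr (gramC v w); lra.
Qed.

Lemma rk_mem_kernel v : rk_mem (kernel_comb v).
Proof. exact: rk_memP (kernel_comb_bound v). Qed.

Lemma rk_norm_kernel v : rk_norm (kernel_comb v) <= gram v v.
Proof. exact: rk_norm_le (kernel_comb_bound v). Qed.

(** Completing the square: the value of [f - kernel_comb v] at [w] is the value of [f] at [w ++ v]
    minus its value at [v]. So a near-maximiser [v] for [rk_norm f] approximates [f]. *)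
Lemma kernel_comb_dense f (e : R) : rk_mem f -> 0 < e ->
  exists v, rk_norm (f - kernel_comb v) < e.
Proof.
move=> hf e0.
have hs : has_sup (rk_values f).
  by split=> //; exists (2 * lincomb f [::] - gram [::] [::]), [::].
have [_ [v _ <-] hv] := sup_adherent (divr_gt0 e0 (@ltr0n R 2)) hs.
exists v; apply: (@le_lt_trans _ _ (e / 2)); last by lra.
apply: rk_norm_le => w; have := rk_norm_ub (w ++ v) hf.
rewrite lincombB lincomb_kernel lincomb_cat !gram_catl !gram_catr (gramC v w).
move: hv; rewrite -/(rk_norm f); lra.
Qed.

(** A combination whose kernel function vanishes has Gram value zero, so a nonzero value of [f] on
    it could be scaled up to make the supremum infinite. Linear identities of the kernel are thereby
    inherited by all members of the space. *)
Lemma rk_null_relation (s : seq (R * I)) f : rk_mem f ->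
  (forall j, \sum_(a <- s) a.1 * k a.2 j = 0) ->
  \sum_(a <- s) a.1%:C * f a.2 = 0.
Proof.
move=> hf s0; set z := \sum_(a <- s) _.
pose v := [seq (Num.conj z * a.1%:C, a.2) | a <- s].
have lv : lincomb f v = normc2 z.
  have -> : normc2 z = Re (Num.conj z * z) by rewrite mulrC mulcJ_normc2.
  rewrite {2}/z /lincomb big_map mulr_sumr.
  rewrite (big_morph _ (@ReD R) (erefl : Re (0 : R[i]) = 0)).
  by apply: eq_bigr => a _ /=; rewrite mulrA.
have gv : gram v v = 0.
  rewrite /gram big_map big1// => a _ /=; rewrite big_map /=.
  transitivity (\sum_(b <- s) (normc2 z * a.1) * (b.1 * k b.2 a.2)); last first.
    by rewrite -mulr_sumr s0 mulr0.
  apply: eq_bigr => b _; rewrite (k_sym a.2) mulrA; congr (_ * _).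
  rewrite /normc2 !ReM !Re_conj !Im_conj !ReM !ImM !Re_conj !Im_conj /=; ring.
apply: normc2_eq0; apply/le_anti; rewrite normc2_ge0 andbT leNgt.
apply/negP => z0.
have := rk_norm_ub (scale_comb ((rk_norm f + 1) / (2 * normc2 z))%:C v) hf.
rewrite lincomb_scaleR lv gram_scaleRl gram_scaleRr gv !mulr0 subr0.
have -> : 2 * ((rk_norm f + 1) / (2 * normc2 z) * normc2 z) = rk_norm f + 1.
  by field; rewrite gt_eqF.
by rewrite gerDl ler10.
Qed.

Lemma lincomb_comp (u : I -> I) f v :
  lincomb (f \o u) v = lincomb f [seq (a.1, u a.2) | a <- v].
Proof. by rewrite /lincomb big_map. Qed.

Section Isometry.
Variable u : I -> I.
Hypothesis k_u : forall i j, k (u i) (u j) = k i j.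

Lemma gram_comp v :
  gram [seq (a.1, u a.2) | a <- v] [seq (a.1, u a.2) | a <- v] = gram v v.
Proof.
rewrite /gram big_map; apply: eq_bigr => a _; rewrite big_map.
by apply: eq_bigr => b _ /=; rewrite k_u.
Qed.

Lemma rk_mem_comp f : rk_mem f -> rk_mem (f \o u).
Proof.
move=> hf; apply: (@rk_memP _ (rk_norm f)) => v.
by rewrite lincomb_comp -gram_comp; exact: rk_norm_ub.
Qed.

Lemma rk_norm_comp f : rk_mem f -> rk_norm (f \o u) <= rk_norm f.
Proof.
move=> hf; apply: rk_norm_le => v.
by rewrite lincomb_comp -gram_comp; exact: rk_norm_ub.
Qed.

End Isometry.

Lemma kernel_comb_cat v w : kernel_comb (v ++ w) = kernel_comb v + kernel_comb w.
Proof. by apply/funext => j; rewrite /kernel_comb big_cat. Qed.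

Lemma kernel_comb_scaleR (t : R) v :
  kernel_comb (scale_comb t%:C v) = t%:C *: kernel_comb v.
Proof.
apply/funext => j; transitivity (t%:C * kernel_comb v j); last by [].
rewrite /kernel_comb /scale_comb big_map mulr_sumr.
by apply: eq_bigr => a _; rewrite mulrA [(_, _).1]/= rmorphM /= conj_realC.
Qed.

End ReproducingKernel.

(** * Hilbert-Schmidt forms *)

(* The forms [x |-> <T x, x>], [T] a Hilbert-Schmidt operator: the reproducing
   kernel space of [|<x, y>|^2]. *)
Section QuadraticForms.
Variables (R : realType) (H : hilbertType R).
Implicit Types (x y e : H) (f : H -> R[i]).

Definition sqinner x y : R := normc2 (inner x y).

Lemma sqinnerC x y : sqinner x y = sqinner y x.
Proof. by rewrite /sqinner innerC normc2_conj. Qed.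

Lemma sqinner_ge0 x y : 0 <= sqinner x y. Proof. exact: normc2_ge0. Qed.

Lemma sqinner_diag x : sqinner x x = nsq x ^+ 2.
Proof. by rewrite /sqinner inner_nsq normc2R. Qed.

Lemma Re_sum (I : Type) (r : seq I) (F : I -> R[i]) :
  Re (\sum_(i <- r) F i) = \sum_(i <- r) Re (F i).
Proof. exact: (big_morph _ (@ReD R) (erefl : Re (0 : R[i]) = 0)). Qed.

(** The Gram value is the squared Hilbert-Schmidt norm of the operator that sends [y] to the sum of
    the [a.1 <y, a.2> a.2]; it is computed on an orthonormal family [es] whose span contains all the
    [a.2]. *)
Lemma gram_sqinner_ge0 (v : seq (R[i] * H)) : 0 <= gram sqinner v v.
Proof.
have [es oes hes] := gram_schmidt [seq a.2 | a <- v].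
have -> : gram sqinner v v =
    \sum_(e <- es) nsq (\sum_(a <- v) (a.1 * Num.conj (inner a.2 e)) *: a.2).
  pose T a b e := (a.1 * Num.conj (inner a.2 e)) *
    (Num.conj (b.1 * Num.conj (inner b.2 e)) * inner a.2 b.2) : R[i].
  transitivity (Re (\sum_(a <- v) \sum_(b <- v) \sum_(e <- es) T a b e)).
    rewrite Re_sum /gram; apply: eq_big_seq => a av.
    rewrite Re_sum; apply: eq_big_seq => b bv.
    rewrite /sqinner -ReMr -mulcJ_normc2; congr Re.
    have pa : proj es a.2 = a.2 by apply: hes; apply: map_f.
    rewrite [in Num.conj (inner _ _)](inner_projE _ pa) rmorph_sum /= !mulr_sumr.
    apply: eq_bigr => e _; rewrite /T !rmorphM /= !conjCK; ring.
  have -> : \sum_(a <- v) \sum_(b <- v) \sum_(e <- es) T a b e =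
      \sum_(e <- es) \sum_(a <- v) \sum_(b <- v) T a b e.
    rewrite [RHS]exchange_big; apply: eq_bigr => a _.
    by rewrite [RHS]exchange_big.
  rewrite Re_sum; apply: eq_bigr => e _; rewrite /nsq inner_suml; congr Re.
  apply: eq_bigr => a _; rewrite inner_sumr; apply: eq_bigr => b _.
  by rewrite innerZl innerZr /T.
by apply: sumr_ge0 => e _; exact: nsq_ge0.
Qed.

Local Notation mem := (rk_mem sqinner).
Local Notation norm := (rk_norm sqinner).

Lemma sqinner_par x y z :
  sqinner (x + y) z + sqinner (x - y) z = 2 * (sqinner x z + sqinner y z).
Proof.
rewrite /sqinner innerDl innerBl /normc2 !ReD !ImD ReN ImN; ring.
Qed.

(** The kernel obeys the parallelogram law in its first variable; [rk_null_relation] transfers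
    it. *)
Lemma form_par f x y : mem f -> f (x + y) + f (x - y) = 2 * (f x + f y).
Proof.
move=> hf.
have s0 j : \sum_(a <- [:: (1, x + y); (1, x - y); (-2, x); (-2, y)])
    a.1 * sqinner a.2 j = 0.
  by rewrite !big_cons big_nil /=; have := sqinner_par x y j; lra.
have := rk_null_relation sqinnerC hf s0.
rewrite !big_cons big_nil /= rmorphN rmorph1 rmorph_nat => h.
by apply/eqP; rewrite -subr_eq0; apply/eqP; rewrite -[RHS]h; ring.
Qed.

Lemma formZ f c x : mem f -> f (c *: x) = (normc2 c)%:C * f x.
Proof.
move=> hf.
have s0 j : \sum_(a <- [:: (1, c *: x); (- normc2 c, x)])
    a.1 * sqinner a.2 j = 0.
  rewrite !big_cons big_nil /= /sqinner innerZl normc2M; ring.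
have := rk_null_relation sqinnerC hf s0.
rewrite !big_cons big_nil /= rmorphN rmorph1 => h.
by apply/eqP; rewrite -subr_eq0; apply/eqP; rewrite -[RHS]h; ring.
Qed.

Lemma form_bound f x : mem f -> normc2 (f x) <= norm f * nsq x ^+ 2.
Proof.
by move=> hf; rewrite -sqinner_diag; apply: rk_eval => //; exact: gram_sqinner_ge0.
Qed.

End QuadraticForms.

(** * The action on forms and its strong continuity *)

Section FormAction.
Variables (R : realType) (G : topologicalGroupType) (H : hilbertType R).
Variables (pi : G -> H -> H).
Hypotheses (pi_rep : unitary_rep pi) (pi_cont : strongly_continuous pi).
Implicit Types (x y : H) (f : H -> R[i]) (g h : G).

Local Notation k := (@sqinner R H).
Local Notation mem := (rk_mem k).
Local Notation norm := (rk_norm k).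

Definition form_act g f : H -> R[i] := f \o pi g^-1%g.

Lemma sqinner_rep g x y : k (pi g x) (pi g y) = k x y.
Proof. by rewrite /sqinner (unitary_inner (rep_unitary pi_rep g)). Qed.

Lemma form_act1 f : form_act 1%g f = f.
Proof. by apply/funext => x; rewrite /form_act/= invg1 (rep1 pi_rep). Qed.

Lemma form_actM g h f : form_act (g * h)%g f = form_act g (form_act h f).
Proof. by apply/funext => x; rewrite /form_act/= invgM (repM pi_rep). Qed.

Lemma form_act_mem g f : mem f -> mem (form_act g f).
Proof. by apply: rk_mem_comp; exact: sqinner_rep. Qed.

Lemma form_act_norm g f : mem f -> norm (form_act g f) = norm f.
Proof.
move=> hf; apply/le_anti/andP; split.
  by apply: rk_norm_comp => //; exact: sqinner_rep.
rewrite -[X in norm X <= _]form_act1 -(mulVg g) form_actM.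
apply: rk_norm_comp; [exact: sqinner_rep | exact: form_act_mem].
Qed.

Lemma cvg_inner_rep x y :
  k x (pi g y) @[g --> (1%g : G)] --> k x y.
Proof.
have h (p : R[i] -> R) : (forall c d, p (c - d) = p c - p d) ->
    (forall c, p c ^+ 2 <= normc2 c) ->
    p (inner x (pi g y)) @[g --> (1%g : G)] --> p (inner x y).
  move=> pB ple; apply/cvgrPdist_lt => e e0.
  have k1 : 0 < nsq x + 1 by rewrite ltr_wpDl// nsq_ge0.
  have e1 : 0 < e ^+ 2 / (nsq x + 1) by rewrite divr_gt0// exprn_gt0.
  apply: filterS (rep_nbhs1 pi_rep pi_cont y e1) => g /=.
  rewrite ltr_pdivlMr// => yg.
  rewrite -pB -innerBr -(@ltr_pXn2r _ 2)// ?nnegrE ?(ltW e0)// real_normK ?num_real//.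
  apply: (le_lt_trans (ple _)); apply: (le_lt_trans (inner_CauchySchwarz _ _)).
  apply: le_lt_trans yg; rewrite mulrC ler_wpM2l ?nsq_ge0// lerDl//.
rewrite /sqinner /normc2 -![_ ^+ 2]/(_ * _).
apply: cvgD; apply: cvgM; apply: h => c.
all: try (by move=> d; rewrite ?ReD ?ImD ?ReN ?ImN).
all: by rewrite ?lerDl ?lerDr sqr_ge0.
Qed.

Lemma kernel_comb_act g v :
  form_act g (kernel_comb k v) = kernel_comb k [seq (a.1, pi g a.2) | a <- v].
Proof.
apply/funext => x; rewrite /form_act /kernel_comb /= big_map.
apply: eq_bigr => a _ /=; rewrite -(sqinner_rep g a.2) (repVK pi_rep).
by [].
Qed.

Lemma form_act_cont f (e : R) : mem f -> 0 < e ->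
  nbhs (1%g : G) [set g | norm (f - form_act g f) < e].
Proof.
move=> hf e0.
have P0 := @gram_sqinner_ge0 R H; have S := @sqinnerC R H.
(* The approximant moves by at most [e / 8], and each of the two approximation errors is below
   [e / 16]; in total [2 (1/16 + 2 (1/8 + 1/16)) e = 7 e / 8]. *)
have [v hv] := kernel_comb_dense (@sqinnerC R H) hf (divr_gt0 e0 (@ltr0n R 16)).
have kv := rk_mem_kernel (@sqinnerC R H) (@gram_sqinner_ge0 R H) v.
pose gv g := [seq (a.1, pi g a.2) | a <- v].
have cv : gram k v (gv g) @[g --> (1%g : G)] --> gram k v v.
  rewrite /gram; apply: cvg_big; first exact: add_continuous.
  move=> a _.
  rewrite (_ : (fun g => _) = (fun g => \sum_(b <- v)
    Re (a.1 * Num.conj b.1) * k a.2 (pi g b.2))); last first.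
    by apply/funext => g; rewrite big_map.
  apply: cvg_big; first exact: add_continuous.
  by move=> b _; apply: cvgM; [exact: cvg_cst | exact: cvg_inner_rep].
have e16 : 0 < e / 16 by rewrite divr_gt0.
move/cvgrPdist_lt : cv => /(_ _ e16); apply: filterS => g /= /ltr_normlW hg.
have m1 : mem (f - kernel_comb k v).
  exact: rk_memB.
pose d := kernel_comb k v - form_act g (kernel_comb k v).
have dE : d = kernel_comb k (v ++ scale_comb (-1)%:C (gv g)).
  rewrite kernel_comb_cat kernel_comb_scaleR rmorphN rmorph1 scaleN1r.
  by rewrite /d kernel_comb_act.
have md : mem d by rewrite dE; exact: rk_mem_kernel.
have nd : norm d <= e / 8.
  rewrite dE; apply: le_trans (rk_norm_kernel S P0 _) _.
  rewrite !gram_catl !gram_catr// !gram_scaleRl !gram_scaleRr// (gramC S (gv g) v).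
  rewrite /gv gram_comp; last exact: sqinner_rep.
  by rewrite -/(gv g); lra.
have -> : f - form_act g f = (f - kernel_comb k v) +
    (d + (-1) *: form_act g (f - kernel_comb k v)).
  apply/funext => x; rewrite /form_act/= /d.
  have E (a b c c' : R[i]) : a - c = a - b + (b - c' + (-1) * (c - c')) by ring.
  exact: E.
have m2 := form_act_mem g m1.
have m3 : mem ((-1) *: form_act g (f - kernel_comb k v)) by apply: rk_memZ.
have := rk_normD_le S P0 m1 (rk_memD S md m3).
have := rk_normD_le S P0 md m3.
rewrite rk_normZ// normc2N normc2R expr1n mul1r form_act_norm//; lra.
Qed.

Definition form_quad : quadspace (H -> R[i]) :=
  rk_quad (@sqinnerC R H) (@gram_sqinner_ge0 R H).

Definition form_action : quad_action G form_quad.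
Proof.
refine (@QuadAction R G _ form_quad form_act _ _ _ _ _ _).
- by [].
- by move=> g f /asboolP hf; apply/asboolP; exact: form_act_mem.
- by move=> g f /asboolP; exact: form_act_norm.
- exact: form_act1.
- exact: form_actM.
- by move=> f /asboolP hf e; exact: form_act_cont.
Defined.

End FormAction.

(** * Invariant forms *)

(** By compactness of [[a, b]] the values of [p] converge along [U]; the set sought is the preimage
    of a small ball around the limit. *)
Lemma ultra_bounded_small_variation (R : realType) (T : Type) (U : set_system T)
    (p : T -> R) (a b e : R) :
  UltraFilter U -> U [set x | a <= p x <= b] -> 0 < e ->
  exists2 A, U A & forall x z, A x -> A z -> `|p z - p x| < e.
Proof.
move=> UU Uab e0; have PU := @ultra_proper _ _ UU.
have Uab' : (p @ U) `[a, b]%classic.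
  by change (U [set x | p x \in `[a, b]]); apply: filterS Uab => x /=; rewrite in_itv.
have [l [_ cl]] := segment_compact (fmap_proper_filter p PU) Uab'.
have e2 : 0 < e / 2 by rewrite divr_gt0.
have [UA|UA] := in_ultra_setVsetC (p @^-1` ball l (e / 2)) UU.
  exists (p @^-1` ball l (e / 2)) => // x z.
  rewrite -ball_normE /= => lx lz.
  have -> : p z - p x = (l - p x) - (l - p z) by ring.
  by rewrite (le_lt_trans (ler_normB _ _))// [ltRHS]splitr ltrD.
have [r [/= nr br]] := cl (~` ball l (e / 2)) (ball l (e / 2)) UA (nbhsx_ballx _ _ e2).
by case: nr.
Qed.

Section InvariantForms.
Variables (R : realType) (G : topologicalGroupType) (H : hilbertType R).
Variables (pi : G -> H -> H).
Hypotheses (pi_rep : unitary_rep pi) (pi_cont : strongly_continuous pi).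
Hypothesis pi_free : forall x, (forall g, pi g x = x) -> x = 0.
Hypothesis hMAP : minimally_almost_periodic R G.
Implicit Types (x y : H).

Local Notation k := (@sqinner R H).
Local Notation mem := (rk_mem k).
Local Notation norm := (rk_norm k).

Lemma gram_orthonormal es : orthonormal es ->
  gram k [seq (1%:C, e) | e <- es] [seq (1%:C, e) | e <- es] = (size es)%:R.
Proof.
elim: es => [|e es IH] /=; first by rewrite /gram big_nil.
move=> [e1 eorth oes]; rewrite -cat1s gram_catl !(gram_catr (@sqinnerC R H)) IH//.
rewrite (gramC (@sqinnerC R H) _ [:: _]).
have -> : gram k [:: (1%:C, e)] [seq (1%:C, e) | e <- es] = 0.
  rewrite /gram big_seq1 big_map big_seq big1// => f fes /=.
  by rewrite /sqinner eorth// normc2R expr0n mulr0.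
rewrite /gram !big_seq1 mulcJ_normc2 normc2R sqinner_diag e1 !expr1n /=.
by rewrite !mulr1 addr0 add0r -natr1 addrC.
Qed.

Variable f : H -> R[i].
Hypotheses (hf : mem f) (f_inv : forall g x, f (pi g x) = f x).

Let fr x := Re (f x).

Let fr_par x y : fr (x + y) + fr (x - y) = 2 * (fr x + fr y).
Proof. by rewrite -ReD form_par// !mulr_natl mulr2n !ReD -mulr2n. Qed.

Let frZ c x : fr (c *: x) = normc2 c * fr x.
Proof. by rewrite /fr formZ// mulrC ReMr mulrC. Qed.

Lemma Re_form_bound h x : mem h -> `|Re (h x)| <= Num.sqrt (norm h) * nsq x.
Proof.
move=> hh; rewrite -(@ler_pXn2r _ 2)// ?nnegrE ?mulr_ge0 ?sqrtr_ge0 ?nsq_ge0//.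
rewrite real_normK ?num_real// exprMn sqr_sqrtr ?rk_norm_ge0//.
by apply: le_trans (form_bound x hh); rewrite lerDl sqr_ge0.
Qed.

Let B := Num.sqrt (norm f).
Let frB x : `|fr x| <= B * nsq x. Proof. exact: Re_form_bound. Qed.
Let B0 : 0 <= B. Proof. exact: sqrtr_ge0. Qed.

Let S : set R := [set fr x | x in [set x | nsq x = 1]].
Let tau := sup S.

Variable x0 : H.
Hypothesis fx0 : 0 < fr x0.

Let nsq_normalize x : x != 0 -> nsq ((Num.sqrt (nsq x))^-1%:C *: x) = 1.
Proof.
move=> xn; have x0' : 0 < nsq x.
  rewrite lt_def nsq_ge0 andbT; apply: contra xn => /eqP ?.
  by apply/eqP; exact: nsq_eq0.
by rewrite nsqZ normc2R exprVn sqr_sqrtr ?nsq_ge0// mulVf// gt_eqF.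
Qed.

Let fr0 : fr 0 = 0.
Proof. by rewrite -(scale0r 0) frZ normc2R expr0n mul0r. Qed.

Let x0n : x0 != 0.
Proof. by apply: contraTneq fx0 => ->; rewrite fr0 ltxx. Qed.

Let hS : has_sup S.
Proof.
split; first by exists (fr ((Num.sqrt (nsq x0))^-1%:C *:
  x0)), ((Num.sqrt (nsq x0))^-1%:C *: x0) => //; exact: nsq_normalize.
exists B => _ [x /= x1 <-]; apply: le_trans (ler_norm _) _.
by apply: le_trans (frB x) _; rewrite x1 mulr1.
Qed.

Let fr_tau x : fr x <= tau * nsq x.
Proof.
have [->|xn] := eqVneq x 0; first by rewrite fr0 nsq0 mulr0.
have n1 := nsq_normalize xn.
have : fr ((Num.sqrt (nsq x))^-1%:C *: x) <= tau.
  by apply: ub_le_sup; [case: hS|exists ((Num.sqrt (nsq x))^-1%:C *: x)].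
rewrite frZ; move: n1; rewrite nsqZ; set c := normc2 _ => c1 h.
have c0 : 0 <= c := normc2_ge0 _.
have := ler_wpM2r (nsq_ge0 x) h.
by rewrite mulrAC c1 mul1r.
Qed.

Let tau_gt0 : 0 < tau.
Proof.
have := lt_le_trans fx0 (fr_tau x0).
have n0 : 0 < nsq x0.
  rewrite lt_def nsq_ge0 andbT; apply: contra x0n => /eqP ?.
  by apply/eqP; exact: nsq_eq0.
by rewrite pmulr_lgt0.
Qed.

(** With [T] the operator of [f], this is the form of [tau - Re T], nonnegative by the choice of
    [tau]. By the parallelogram law its zero set [E] is a subspace, the eigenspace of [Re T] for
    [tau]. *)
Let q x := tau * nsq x - fr x.
Let q_ge0 x : 0 <= q x. Proof. by rewrite subr_ge0 fr_tau. Qed.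
Let q_par x y : q (x + y) + q (x - y) = 2 * (q x + q y).
Proof. by have := fr_par x y; have := congr1 (fun t => tau * t) (nsq_par x y);
  rewrite /q /=; lra. Qed.
Let qZ c x : q (c *: x) = normc2 c * q x.
Proof. rewrite /q nsqZ frZ; ring. Qed.
Let qD_le x y : q (x + y) <= 2 * (q x + q y).
Proof. by have := q_par x y; have := q_ge0 (x - y); lra. Qed.
Let qB_le x y : q (x - y) <= 2 * (q x + q y).
Proof. by have := q_par x y; have := q_ge0 (x + y); lra. Qed.
Let q_bound x : q x <= (tau + B) * nsq x.
Proof. by have := frB x; rewrite ler_norml /q mulrDl => /andP[]; lra. Qed.

Let E x := q x = 0.

Let q_cont x : (forall e :
  R, 0 < e -> exists y, q y <= e /\ nsq (x - y) < e) -> q x = 0.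
Proof.
move=> h; apply/le_anti; rewrite q_ge0 andbT; apply/ler_addgt0Pr => e e0.
rewrite add0r; have M0 : 0 < 2 * (1 + tau + B) by have := tau_gt0; have := B0; lra.
have [|y [qy xy]] := h (e / (2 * (1 + tau + B))); first by rewrite divr_gt0.
have := qD_le y (x - y); rewrite addrC subrK => hx.
have := q_bound (x - y).
have tB : 0 <= tau + B by have := tau_gt0; have := B0; lra.
have := ler_wpM2l tB (ltW xy).
have : e = e / (2 * (1 + tau + B)) * (2 * (1 + tau + B)) by rewrite divfK// gt_eqF.
move: qy; set t := e / _; move: hx; lra.
Qed.

Let hE : closed_subspace E.
Proof.
split.
- by rewrite /E /q fr0 nsq0 mulr0 subrr.
- move=> x y Ex Ey; apply/le_anti; rewrite q_ge0 andbT.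
  by apply: le_trans (qD_le x y) _; rewrite Ex Ey addr0 mulr0.
- by move=> c x Ex; rewrite /E qZ Ex mulr0.
- move=> x hx; apply: q_cont => e /hx [y Ey xy]; exists y; split=> //.
  by rewrite Ey; apply: le_trans (nsq_ge0 _) (ltW xy).
Qed.

Let E_inv g x : E x -> E (pi g x).
Proof. by rewrite /E /q /fr f_inv (rep_nsq pi_rep). Qed.

(** On [E] every unit vector has value [tau], so testing [norm f] with [tau] times the sum of the
    point masses at [es] gives [(size es) * tau^2 <= norm f]. *)
Let E_dim es : orthonormal es -> (forall e, e \in es -> E e) ->
  (size es <= Num.truncn (norm f / tau ^+ 2))%N.
Proof.
move=> oes Ees; rewrite truncn_ge_nat ?divr_ge0 ?sqr_ge0 ?rk_norm_ge0// ler_pdivlMr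
  ?exprn_gt0//.
have := rk_norm_ub (scale_comb tau%:C [seq (1%:C, e) | e <- es]) hf.
rewrite lincomb_scaleR gram_scaleRl (gram_scaleRr (@sqinnerC R H)) gram_orthonormal//.
have -> : lincomb f [seq (1%:C, e) | e <- es] = (size es)%:R * tau.
  have nE e : e \in es -> fr e = tau.
    move=> ees; have := Ees e ees; rewrite /E /q.
    suff -> : nsq e = 1 by lra.
    elim: es oes {Ees} ees => // a es IH [a1 _ oes].
    by rewrite in_cons => /orP[/eqP->//|]; exact: IH.
  rewrite /lincomb big_map big_seq (eq_bigr (fun=> tau)); last first.
    by move=> e ees; rewrite mul1r; exact: nE.
  by rewrite -big_seq big_const_seq count_predT iter_addr addr0 mulr_natl.
lra.
Qed.

Let E_zero x : E x -> x = 0.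
Proof.
move=> Ex; apply: pi_free => g.
pose A := subrep_action hE pi_rep pi_cont E_inv.
have tr := hMAP (finite_dimensional_subspace hE E_dim)
  (rep_of_action_unitary A) (@rep_of_action_continuous _ _ _ _ A).
have Ex' : `[<E x>] by apply/asboolP.
exact: (congr1 val (tr g (exist (fun x => qmem (subspace_quad hE) x) x Ex'))).
Qed.

Let Sd (d : R) : set H := [set x | nsq x = 1 /\ q x < d].

Let Sd_proper : ProperFilter (filter_from [set d : R | 0 < d] Sd).
Proof.
apply: filter_from_proper.
  apply: filter_from_filter; first by exists 1; exact: ltr01.
  move=> i j /= i0 j0; exists (Num.min i j); first by rewrite lt_min i0 j0.
  by move=> x [x1]; rewrite lt_min => /andP[xi xj]; split.
move=> d /= d0; have [_ [x /= x1 <-] hx] := sup_adherent d0 hS.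
by exists x; split=> //; rewrite /q x1 mulr1; move: hx; rewrite -/tau; lra.
Qed.

(** Finite-rank forms are weakly continuous, and the ultrafilter stands in for a weakly convergent
    net of unit vectors: each [<a, x>] is nearly constant on a member of [U], so [<a, z - x>] is
    small there. *)
Lemma kernel_comb_small_variation (U : set_system H) v (e : R) :
  UltraFilter U -> U [set x | nsq x = 1] -> 0 < e ->
  exists2 A, U A & forall x z, A x -> A z -> `|Re (kernel_comb k v (z - x))| < e.
Proof.
move=> UU U1; have PU := @ultra_proper _ _ UU.
elim: v e => [|[c a] v IH] e e0.
  by exists setT => [|x z _ _]; [exact: filterT|rewrite /kernel_comb big_nil normr0].
have part (p : R[i] -> R) d : (forall c d, p (c - d) = p c - p d) ->
    (forall c, p c ^+ 2 <= normc2 c) -> 0 < d ->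
    exists2 A, U A & forall x z, A x -> A z -> p (inner a (z - x)) ^+ 2 <= d.
  move=> pB ple d0; pose M := nsq a + 1.
  have Ub : U [set x | - M <= p (inner a x) <= M].
    apply: filterS U1 => x /= x1; rewrite -ler_norml.
    have a0 := nsq_ge0 a.
    rewrite -(@ler_pXn2r _ 2)// ?nnegrE ?addr_ge0// real_normK ?num_real//.
    apply: (le_trans (ple _)); apply: (le_trans (inner_CauchySchwarz _ _)).
    by rewrite x1 mulr1 /M; nra.
  have sd : 0 < Num.sqrt d by rewrite sqrtr_gt0.
  have [A UA hA] := ultra_bounded_small_variation UU Ub sd.
  exists A => // x z Ax Az; rewrite innerBr pB -real_normK ?num_real//.
  rewrite -[leRHS]sqr_sqrtr ?(ltW d0)//.
  by rewrite ler_pXn2r ?nnegrE ?sqrtr_ge0// ltW// hA.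
(* The squared real and imaginary parts are each at most [e / M], and
   [|Re c| * 2 e / M <= e / 2]. *)
pose M := 4 * (`|Re c| + 1).
have M0 : 0 < M by rewrite mulr_gt0// ltr_wpDl.
have [e2 eM] : 0 < e / 2 /\ 0 < e / M by rewrite !divr_gt0.
have [A UA hA] := IH _ e2.
have [A1 UA1 hA1] := part (@Re R) _ (fun c d => etrans (ReD c (- d)) (congr1 _ (ReN d)))
  (fun c => ler_wpDr (sqr_ge0 (Im c)) (lexx _)) eM.
have [A2 UA2 hA2] := part (@Im R) _ (fun c d => etrans (ImD c (- d)) (congr1 _ (ImN d)))
  (fun c => ler_wpDl (sqr_ge0 (Re c)) (lexx _)) eM.
exists (A `&` (A1 `&` A2)); first exact: filterI UA (filterI UA1 UA2).
move=> x z [Ax [A1x A2x]] [Az [A1z A2z]].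
rewrite /kernel_comb big_cons -/(kernel_comb k v (z - x)) ReD ReMr Re_conj /=.
rewrite (le_lt_trans (ler_normD _ _))// [ltRHS]splitr ler_ltD ?hA//.
rewrite normrM (ger0_norm (sqinner_ge0 _ _)) /sqinner /normc2.
have h1 := hA1 _ _ A1x A1z; have h2 := hA2 _ _ A2x A2z.
apply: (@le_trans _ _ (`|Re c| * (2 * (e / M)))); first by rewrite ler_wpM2l//; lra.
have -> : e / 2 = (`|Re c| + 1) * (2 * (e / M)).
  by rewrite /M; field; rewrite gt_eqF// ltr_wpDl.
by rewrite ler_wpM2r ?lerDl// mulr_ge0// ltW.
Qed.

(** The supremum [tau] would be attained. For near-maximisers [x], [z] the value [q (z - x)] is
    small, and along an ultrafilter so is the finite-rank approximant of [f] at [z - x]; then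
    [tau |z - x|^2 = q (z - x) + fr (z - x)] makes them Cauchy. The limit lies in [E], hence is
    zero, although it is close to unit vectors. *)
Lemma invariant_form_absurd : False.
Proof.
have [U [UU FU]] := ultraFilterLemma Sd_proper.
have PU := @ultra_proper _ _ UU.
have USd d : 0 < d -> U (Sd d) by move=> d0; apply: FU; exists d.
have U1 : U [set x | nsq x = 1] by apply: filterS (USd _ ltr01) => x [].
have t2 : 0 < (tau / 2) ^+ 2 by rewrite exprn_gt0// divr_gt0.
have P0 := @gram_sqinner_ge0 R H; have Ss := @sqinnerC R H.
have [v hv] := kernel_comb_dense Ss hf t2.
have mkv : mem (f - kernel_comb k v) by exact: rk_memB (rk_mem_kernel Ss P0 v).
have close x : fr x - Re (kernel_comb k v x) <= tau / 2 * nsq x.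
  rewrite -ReN -ReD; apply: le_trans (ler_norm _) _.
  apply: le_trans (Re_form_bound x mkv) _; rewrite ler_wpM2r ?nsq_ge0//.
  rewrite -[leRHS]ger0_norm ?divr_ge0 ?(ltW tau_gt0)// -sqrtr_sqr.
  by rewrite ler_wsqrtr// ltW.
have [|y hy] := nsq_complete PU.
(* This gives [q (z - x) < e tau / 4], while [fr (z - x)] exceeds [tau / 2 * nsq (z - x)] by less
   than [e tau / 16]; hence [nsq (z - x) < 5 e / 8]. *)
- move=> e e0; have d0 : 0 < e * tau / 16 by rewrite divr_gt0// mulr_gt0.
  have [A UA hA] := kernel_comb_small_variation v UU U1 d0.
  have UA' : U (A `&` Sd (e * tau / 16)) by exact: filterI UA (USd _ d0).
  have [z [Az [_ qz]]] := filter_ex UA'; exists z.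
  apply: filterS UA' => x [Ax [_ qx]] /=.
  have := hA _ _ Ax Az; have := close (z - x); have := qB_le z x.
  rewrite ltr_norml {1}/q => h1 h2 /andP[_ h3].
  rewrite -(ltr_pM2l tau_gt0); have := nsq_ge0 (z - x); have := mulr_gt0 e0 tau_gt0.
  lra.
- have y0 : y = 0.
    apply: E_zero; apply: q_cont => e e0.
    have [x [yx [_ qx]]] := filter_ex (filterI (hy e e0) (USd _ e0)).
    by exists x; split=> //; exact: ltW.
  have [x [/= yx x1]] := filter_ex (filterI (hy 1 ltr01) U1).
  by move: yx; rewrite y0 sub0r nsqN x1 ltxx.
Qed.

End InvariantForms.

Lemma invariant_form_eq0 (R : realType) (G : topologicalGroupType)
    (H : hilbertType R) (pi : G -> H -> H) (f : H -> R[i]) :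
  unitary_rep pi -> strongly_continuous pi ->
  (forall x, (forall g, pi g x = x) -> x = 0) ->
  minimally_almost_periodic R G ->
  rk_mem (@sqinner R H) f -> (forall g x, f (pi g x) = f x) -> f = 0.
Proof.
move=> pr pc pf hMAP hf finv; apply/funext => x.
apply/eqP/negP => /negP fx.
(* The factor turns the value at [x] into [|f x|^2], whose real part is positive. *)
apply: (@invariant_form_absurd R G H pi pr pc pf hMAP (Num.conj (f x) *: f) _ _ x).
- exact: (rk_memZ (@gram_sqinner_ge0 R H)).
- by move=> g y; rewrite [LHS]/(Num.conj (f x) * f (pi g y)) finv.
- have -> : (Num.conj (f x) *: f) x = f x * Num.conj (f x) by exact: mulrC.
  rewrite mulcJ_normc2 /= lt_def normc2_ge0 andbT.
  by apply: contra fx => /eqP h; apply/eqP; exact: normc2_eq0.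
Qed.

(** * The contraction and the superharmonic form *)

Section SpectralGap.
Variables (R : realType) (G : topologicalGroupType) (H : hilbertType R).
Variables (pi : G -> H -> H).
Hypotheses (pi_rep : unitary_rep pi) (pi_cont : strongly_continuous pi).
Hypothesis pi_free : forall x, (forall g, pi g x = x) -> x = 0.
Hypothesis hMAP : minimally_almost_periodic R G.
Implicit Types (x y : H) (f : H -> R[i]).

Local Notation k := (@sqinner R H).
Local Notation mem := (rk_mem k).
Local Notation norm := (rk_norm k).
Local Notation act := (form_act pi).
Let P0 := @gram_sqinner_ge0 R H.
Let Ss := @sqinnerC R H.

Lemma form_sqrt_triangle f h : mem f -> mem h ->
  Num.sqrt (norm (f + h)) <= Num.sqrt (norm f) + Num.sqrt (norm h).
Proof.
move=> hf hh.
have hf' : `[<mem f>] by apply/asboolP.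
have hh' : `[<mem h>] by apply/asboolP.
exact: (sqrt_quad_triangle (@hof_quad_ge0 _ _ (form_quad H))
  (@hof_quadZ _ _ (form_quad H)) (@hof_quad_par _ _ (form_quad H))
  (exist (fun f => qmem (form_quad H) f) f hf')
  (exist (fun f => qmem (form_quad H) f) h hh')).
Qed.

(** Otherwise the normalised [f] would be almost invariant under [Q], and the Kazhdan property would
    give an invariant unit form. Taking [e <= 1] keeps [4 - e^2] nonnegative in the contraction. *)
Lemma kazhdan_gap (Q : set G) : kazhdan_set R Q -> exists2 e : R, 0 < e <= 1 &
  forall f, mem f -> 0 < norm f -> exists2 g, Q g & e ^+ 2 * norm f <= norm (f - act
    g f).
Proof.
move=> [e0 e0p hQ]; exists (Num.min e0 1).
  by rewrite lt_min e0p ltr01 ge_min lexx orbT.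
set e := Num.min e0 1; have ep : 0 < e by rewrite lt_min e0p ltr01.
have ee0 : e <= e0 by rewrite ge_min lexx.
move=> f hf fpos; apply: contrapT => hno.
have hno' g : Q g -> norm (f - act g f) < e ^+ 2 * norm f.
  by move=> Qg; rewrite ltNge; apply/negP => h; apply: hno; exists g.
pose c := (Num.sqrt (norm f))^-1.
have c2 : c ^+ 2 * norm f = 1.
  by rewrite exprVn sqr_sqrtr ?(ltW fpos)// mulVf// gt_eqF.
have hu : mem (c%:C *: f) by exact: rk_memZ.
have hu' : `[<mem (c%:C *: f)>] by apply/asboolP.
pose A := form_action pi_rep pi_cont.
pose u : hilbert_of (form_quad H) :=
  exist (fun f => qmem (form_quad H) f) (c%:C *: f) hu'.
have [] := hQ _ _ (rep_of_action_unitary A) (@rep_of_action_continuous _ _ _ _ A).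
  exists u; split.
    rewrite normr_nsq nsq_hof /= [rk_norm _ _]rk_normZ// normc2R c2 sqrtr1.
    by [].
  move=> g Qg; rewrite normr_nsq ltcR nsq_hof hof_valB /=.
  have -> : c%:C *: f - act g (c%:C *: f) = c%:C *: (f - act g f).
    by rewrite scalerBr.
  rewrite rk_normZ ?normc2R; [|exact: P0|]; last first.
    by apply: rk_memB => //; exact: form_act_mem.
  apply: lt_le_trans ee0; rewrite -[ltRHS]ger0_norm ?(ltW ep)// -sqrtr_sqr.
  rewrite ltr_sqrt ?exprn_gt0//.
  have cp : 0 < c ^+ 2 by rewrite exprn_gt0// invr_gt0 sqrtr_gt0.
  by have := hno' g Qg; rewrite -(ltr_pM2l cp) mulrCA c2 mulr1.
move=> eta [eta1 etainv].
have /asboolP meta := valP eta.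
have eta0 : val eta = 0.
  apply: (invariant_form_eq0 pi_rep pi_cont pi_free hMAP meta) => g x.
  have := congr1 val (etainv g^-1%g) => /= h.
  have := congr1 (fun f => f x) h => /=.
  by rewrite /form_act /= invgK.
move: eta1; rewrite (_ : eta = 0) ?normr0; last exact: val_inj.
by move=> /eqP; rewrite eq_sym oner_eq0.
Qed.

Definition form_sum (s : seq G) f : H -> R[i] := \sum_(g <- s) act g f.

Lemma form_sum_mem s f : mem f -> mem (form_sum s f).
Proof.
move=> hf; rewrite /form_sum; apply: big_ind.
- exact: rk_mem0.
- by move=> ? ?; exact: rk_memD.
- by move=> g _; exact: form_act_mem.
Qed.

Lemma form_sum_norm s f : mem f ->
  Num.sqrt (norm (form_sum s f)) <= (size s)%:R * Num.sqrt (norm f).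
Proof.
move=> hf; elim: s => [|g s IH].
  by rewrite /form_sum big_nil rk_norm0// sqrtr0 mul0r.
rewrite /form_sum big_cons -/(form_sum s f).
apply: le_trans (form_sqrt_triangle (form_act_mem pi_rep g hf) (form_sum_mem s hf)) _.
by rewrite form_act_norm//= -natr1 mulrDl mul1r addrC lerD2r.
Qed.

(** The head [1%g] is paired with an element [g] that moves [f]: by the parallelogram inequality
    [|f + g f|^2 <= (4 - e^2) |f|^2], and the other [size s - 1] terms are bounded trivially. The
    element [g] depends on [f], the resulting constant does not. *)
Lemma form_sum_contraction (Q : set G) (s : seq G) : kazhdan_set R Q ->
  (forall g, Q g -> g \in s) -> (0 < size s)%N ->
  exists2 theta : R, 0 <= theta < (size s).+1%:R &
    forall f, mem f -> Num.sqrt (norm (form_sum (1%g ::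
      s) f)) <= theta * Num.sqrt (norm f).
Proof.
move=> /kazhdan_gap [e /andP[e0 e1] gap] Qs s0.
have e21 : e ^+ 2 <= 1 by rewrite expr_le1// ltW.
have e20 : 0 < e ^+ 2 by rewrite exprn_gt0.
pose t := Num.sqrt (4 - e ^+ 2).
have t0 : 0 <= t by exact: sqrtr_ge0.
have t2 : t < 2.
  rewrite -(@ltr_pXn2r _ 2)// ?nnegrE// sqr_sqrtr; lra.
exists (t + (size s).-1%:R).
  rewrite addr_ge0//=; case: s s0 {Qs} => // a r _ /=.
  by rewrite -!natr1; lra.
move=> f hf.
have [f0|fn] := eqVneq (norm f) 0.
  have := form_sum_norm (1%g :: s) hf; rewrite f0 sqrtr0 !mulr0.
  by [].
have fp : 0 < norm f by rewrite lt_def fn rk_norm_ge0.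
have [g Qg hg] := gap f hf fp.
have -> : form_sum (1%g :: s) f = (f + act g f) + form_sum (rem g s) f.
  transitivity (f + (act g f + form_sum (rem g s) f)); last exact: addrA.
  by rewrite /form_sum big_cons (big_rem g) ?Qs//= form_act1.
have mg : mem (act g f) by exact: form_act_mem.
apply: le_trans (form_sqrt_triangle (rk_memD Ss hf mg) (form_sum_mem _ hf)) _.
rewrite mulrDl lerD//; last first.
  by rewrite -(size_rem (Qs g Qg)); exact: form_sum_norm.
rewrite -sqrtrM; last lra.
rewrite ler_wsqrtr//.
have := rk_par Ss hf mg; rewrite form_act_norm//; lra.
Qed.

End SpectralGap.

(** * The geometric series of the contraction *)

Section Superharmonic.
Variables (R : realType) (G : topologicalGroupType) (H : hilbertType R).
Variables (pi : G -> H -> H).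
Hypotheses (pi_rep : unitary_rep pi).
Variables (s : seq G) (theta rho : R).
Hypothesis theta_lt : 0 <= theta < rho.

Local Notation k := (@sqinner R H).
Local Notation mem := (rk_mem k).
Local Notation norm := (rk_norm k).
Let P0 := @gram_sqinner_ge0 R H.
Let Ss := @sqinnerC R H.

Hypothesis contraction : forall f, mem f ->
  Num.sqrt (norm (form_sum pi s f)) <= theta * Num.sqrt (norm f).
Implicit Types (x y : H).

(* [q = \sum_m rho^-m M^m q_E], with [M f = \sum_(g in s) f (g^-1 _)] and
   [q_E = \sum_(e in E) |<e, _>|^2]. *)
Lemma exists_superharmonic (E : seq H) : exists (q : H -> R) (C : R),
  [/\ forall x, 0 <= q x,
      forall x y, q (x + y) + q (x - y) = 2 * (q x + q y),
      forall x, \sum_(g <- s) q (pi g^-1%g x) <= rho * q x,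
      forall x, q x <= C * nsq x &
      forall x y, x \in E -> k x y <= q y].
Proof.
have [th0 thr] := andP theta_lt; have rp : 0 < rho by apply: le_lt_trans thr.
pose a0 y : R := \sum_(e <- E) k e y.
pose M (a : H -> R) x := \sum_(g <- s) a (pi g^-1%g x).
pose a m := iter m M a0.
pose ac m : H -> R[i] := fun x => (a m x)%:C.
have acE m : ac m.+1 = form_sum pi s (ac m).
  apply/funext => x; rewrite /ac /form_sum /a iterS /M rmorph_sum /=.
  by rewrite fct_sumE.
have ac0 : ac 0 = kernel_comb k [seq (1%:C, e) | e <- E].
  apply/funext => x; rewrite /ac /a /= /a0 /kernel_comb big_map rmorph_sum /=.
  by apply: eq_bigr => e _; rewrite conj_realC rmorph1 mul1r.
have mac m : mem (ac m).
  by elim: m => [|m IH]; [rewrite ac0; exact: rk_mem_kernel | rewrite acE;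
    exact: form_sum_mem].
pose N0 := Num.sqrt (norm (ac 0)).
have nac m : Num.sqrt (norm (ac m)) <= theta ^+ m * N0.
  elim: m => [|m IH]; first by rewrite expr0 mul1r.
  rewrite acE; apply: le_trans (contraction (mac m)) _.
  by rewrite exprS -mulrA ler_wpM2l.
have a_ge0 m x : 0 <= a m x.
  elim: m x => [|m IH] x; first by apply: sumr_ge0 => e _; exact: sqinner_ge0.
  by rewrite /a iterS; apply: sumr_ge0 => g _; exact: IH.
have a_le m x : a m x <= theta ^+ m * N0 * nsq x.
  apply: le_trans (_ : Num.sqrt (norm (ac m)) * nsq x <= _); last first.
    by rewrite ler_wpM2r ?nsq_ge0.
  by apply: le_trans (Re_form_bound x (mac m)); exact: ler_norm.
have a_par m x y : a m (x + y) + a m (x - y) = 2 * (a m x + a m y).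
  have := congr1 (@Re R) (form_par x y (mac m)).
  by rewrite !mulr_natl mulr2n !ReD -mulr2n -mulr_natl.
pose u x m := a m x / rho ^+ m.
have rm m : 0 < rho ^+ m by rewrite exprn_gt0.
have u0 x m : 0 <= u x m by rewrite divr_ge0// ltW.
have ule x m : u x m <= geometric (N0 * nsq x) (theta / rho) m.
  rewrite /= ler_pdivrMr// expr_div_n mulrA divfK ?gt_eqF//.
  by have := a_le m x; rewrite [N0 * _ * _]mulrC mulrA.
have tr0 : 0 <= theta / rho by rewrite divr_ge0// ltW.
have tr1 : `|theta / rho| < 1 by rewrite ger0_norm// ltr_pdivrMr// mul1r.
have N00 : 0 <= N0 := sqrtr_ge0 _.
have gcv x : cvgn (series (geometric (N0 * nsq x) (theta / rho))).
  exact: is_cvg_geometric_series.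
have ucv x : cvgn (series (u x)).
  apply: (series_le_cvg _ _ (ule x) (gcv x)) => // m /=.
  by rewrite mulr_ge0 ?exprn_ge0// mulr_ge0// nsq_ge0.
pose q x := limn (series (u x)).
have u_q x : series (u x) @ \oo --> q x by exact: ucv.
have q_lim (x : H) (v : nat -> R) (l : R) :
  v @ \oo --> l -> series (u x) = v -> q x = l.
  by move=> vl uv; rewrite /q uv; apply: cvg_lim.
have le_q x m : series (u x) m <= q x.
  apply: nondecreasing_cvgn_le => //; apply: nondecreasing_series => i _ _.
  exact: u0.
exists q, (N0 / (1 - theta / rho)); split.
- by move=> x; have := le_q x 0%N; rewrite /series /= big_geq.
- move=> x y.
  have h1 : (fun m => series (u (x + y)) m + series (u (x - y)) m) @ \oo -->
      q (x + y) + q (x - y) by exact: cvgD.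
  have h2 : (fun m => 2 * (series (u x) m + series (u y) m)) @ \oo --> 2 * (q x + q y).
    by apply: cvgM; [exact: cvg_cst | exact: cvgD].
  rewrite -(cvg_lim _ h1)// -(cvg_lim _ h2)//; congr (lim (_ @ \oo)).
  apply/funext => m /=; rewrite /series /= -!big_split mulr_sumr;
    apply: eq_bigr => i _ /=.
  by rewrite /u -!mulrDl mulrA a_par.
- move=> x.
  have h1 : (fun m => \sum_(g <- s) series (u (pi g^-1%g x)) m) @ \oo -->
      \sum_(g <- s) q (pi g^-1%g x).
    by apply: cvg_big; [exact: add_continuous | move=> g _; exact: u_q].
  have -> : \sum_(g <- s) q (pi g^-1%g x) =
      limn (fun m => \sum_(g <- s) series (u (pi g^-1%g x)) m).
    by apply/esym; exact: cvg_lim.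
  apply: limr_le; first by apply/cvg_ex; eexists; exact: h1.
  apply: nearW => m.
  (* Applying [M] shifts the index: [M] of the term [u i] is [rho] times the term [u i.+1]. Only the
     nonnegative term of index [0] is lost. *)
  have -> : \sum_(g <- s) series (u (pi g^-1%g x)) m =
      rho * \sum_(0 <= i < m) u x i.+1.
    rewrite /series /= exchange_big mulr_sumr; apply: eq_bigr => i _.
    rewrite /u {2}/a iterS -/(a i) /M -mulr_suml exprS invfM.
    by rewrite [rho * _]mulrC -mulrA; congr (_ * _); field; rewrite !gt_eqF.
  rewrite ler_wpM2l ?(ltW rp)//; apply: le_trans (le_q x m.+1).
  by rewrite /series /= big_nat_recl// lerDr.
- move=> x; apply: le_trans (lim_series_le (ucv x) (gcv x) (ule x)) _.
  rewrite (cvg_lim _ (cvg_geometric_series (a := N0 * nsq x) tr1))//.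
  by rewrite mulrAC.
(* The partial sum of length one is the term of index [0], the sum of the kernels over [E]. *)
- move=> x y xE; apply: le_trans (le_q y 1%N).
  rewrite /series /= big_nat1 /u expr0 divr1 /a /= /a0 (big_rem x)//= lerDl.
  by apply: sumr_ge0 => e _; exact: sqinner_ge0.
Qed.

End Superharmonic.

(** * The potential *)

Section InfConvolution.
Variables (R : realType) (H : hilbertType R) (q : H -> R).
Hypothesis q_ge0 : forall x, 0 <= q x.
Hypothesis q_par : forall x y, q (x + y) + q (x - y) = 2 * (q x + q y).
Implicit Types (x y : H) (c : R).

Lemma quad_at0 : q 0 = 0.
Proof. by have := q_par 0 0; rewrite addr0 subr0; lra. Qed.

(** In operator terms the parallel sum of [c q] and the identity: close to [c q] where that is
    small, saturating at [nsq] where it is large. *)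
Definition inf_conv c x : R := inf [set c * q y + nsq (x - y) | y in setT].

Lemma inf_conv_le c x y : 0 <= c -> inf_conv c x <= c * q y + nsq (x - y).
Proof.
move=> c0; apply: ge_inf; last by exists y.
by exists 0 => _ [z _ <-]; rewrite addr_ge0 ?mulr_ge0 ?nsq_ge0.
Qed.

Lemma inf_conv_ge c x (b : R) :
  (forall y, b <= c * q y + nsq (x - y)) -> b <= inf_conv c x.
Proof.
move=> h; apply: lb_le_inf; last by move=> _ [y _ <-].
by exists (c * q 0 + nsq (x - 0)), 0.
Qed.

Lemma inf_conv_ge0 c x : 0 <= c -> 0 <= inf_conv c x.
Proof.
by move=> c0; apply: inf_conv_ge => y; rewrite addr_ge0 ?mulr_ge0 ?nsq_ge0.
Qed.

Lemma inf_conv_le_nsq c x : 0 <= c -> inf_conv c x <= nsq x.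
Proof. by move=> /(inf_conv_le x 0); rewrite quad_at0 mulr0 add0r subr0. Qed.

Lemma inf_conv_le_quad c x : 0 <= c -> inf_conv c x <= c * q x.
Proof. by move=> /(inf_conv_le x x); rewrite subrr nsq0 addr0. Qed.

(** Competitors [u], [v] for [x], [y] give [u + v], [u - v] for [x + y], [x - y]; half-sum and
    half-difference go back. The parallelogram law of [c q + |.|^2] matches the costs. *)
Lemma inf_conv_par c x y : 0 <= c ->
  inf_conv c (x + y) + inf_conv c (x - y) = 2 * (inf_conv c x + inf_conv c y).
Proof.
move=> c0; apply/le_anti/andP; split.
  have h u v : inf_conv c (x + y) + inf_conv c (x - y) <=
      2 * ((c * q u + nsq (x - u)) + (c * q v + nsq (y - v))).
    have h1 := inf_conv_le (x + y) (u + v) c0.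
    have h2 := inf_conv_le (x - y) (u - v) c0.
    have := nsq_par (x - u) (y - v).
    have -> : x - u + (y - v) = x + y - (u + v) by rewrite opprD addrACA.
    have -> : x - u - (y - v) = x - y - (u - v) by rewrite !opprD addrACA.
    have := congr1 (fun t => c * t) (q_par u v) => /=; lra.
  rewrite -(@ler_pM2l _ (2^-1))// mulKf// -lerBlDr; apply: inf_conv_ge => u.
  rewrite lerBlDr -lerBlDl; apply: inf_conv_ge => v.
  by rewrite lerBlDl; have := h u v; lra.
rewrite -lerBlDr; apply: inf_conv_ge => u; rewrite lerBlDr -lerBlDl.
apply: inf_conv_ge => v; rewrite lerBlDl.
have hlf (z : H) : (2^-1)%:C *: z + (2^-1)%:C *: z = z.
  by rewrite -scalerDl -rmorphD /= (_ : 2^-1 + 2^-1 = 1) ?scale1r//; lra.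
pose a := (2^-1)%:C *: (u + v); pose b := (2^-1)%:C *: (u - v).
have abu : a + b = u.
  by rewrite /a /b -scalerDr addrACA subrr addr0 scalerDr hlf.
have abv : a - b = v.
  by rewrite /a /b -scalerBr opprD opprK addrACA subrr add0r scalerDr hlf.
have h1 := inf_conv_le x a c0; have h2 := inf_conv_le y b c0.
have := congr1 (fun t => c * t) (q_par a b); rewrite abu abv /=.
have := nsq_par (x - a) (y - b).
have -> : x - a + (y - b) = x + y - u by rewrite -abu opprD addrACA.
have -> : x - a - (y - b) = x - y - v by rewrite -abv !opprD addrACA.
lra.
Qed.

(* If [q y >= |<y, x>|^2] then [c q y + |x - y|^2 >= c s^2 + (1 - s)^2], where
   [s] is the real part of [<y, x>]. *)
Lemma inf_conv_unit_ge c x : 3 <= c -> nsq x = 1 ->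
  (forall y, sqinner x y <= q y) -> 3 / 4 <= inf_conv c x.
Proof.
move=> c3 x1 hx; apply: inf_conv_ge => y.
pose s := Re (inner x y).
have s2 : s ^+ 2 <= sqinner x y by rewrite lerDl sqr_ge0.
have sy : s ^+ 2 <= nsq y.
  by apply: le_trans s2 _; have := inner_CauchySchwarz x y; rewrite x1 mul1r.
rewrite nsqD nsqN x1 innerNr ReN -/s.
have h3 : 3 * q y <= c * q y by rewrite ler_wpM2r.
(* Here [3 s^2 + 1 - 2 s + s^2 = (2 s - 1/2)^2 + 3/4]. *)
have := hx y; have := sqr_ge0 (2 * s - 2^-1); nra.
Qed.

End InfConvolution.

Lemma expr_lt_eps (R : realType) (l e : R) : 0 < l < 1 -> 0 < e ->
  exists n, l ^+ n < e.
Proof.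
move=> /andP[l0 l1] e0.
have /cvgrPdist_lt /(_ e e0) [n _ hn] : (fun n => l ^+ n) @ \oo --> (0 : R).
  by apply: cvg_expr; rewrite gtr0_norm.
exists n; have := hn n (leqnn n).
by rewrite /= sub0r normrN ger0_norm// exprn_ge0// ltW.
Qed.

(* A quadratic function bounded by a multiple of [nsq] is uniformly continuous
   on the unit sphere, since [E(p, d) = D(p + d) - D(p - d)] satisfies
   [E(p, 2 d) = 2 E(p, d)]. *)
Lemma bounded_quad_equicontinuous (R : realType) (H : hilbertType R) (D : H -> R)
    (m : R) (n : nat) x y :
  (forall x y, D (x + y) + D (x - y) = 2 * (D x + D y)) ->
  (forall x, `|D x| <= m * nsq x) -> nsq x = 1 -> nsq y = 1 ->
  nsq (x - y) <= 4^-1 ^+ n -> `|D x - D y| <= 4 * m * 2^-1 ^+ n.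
Proof.
move=> Dpar Dbd x1 y1 xy.
have m0 : 0 <= m by have := Dbd x; rewrite x1 mulr1; apply: le_trans.
pose p := (2^-1)%:C *: (x + y); pose d := (2^-1)%:C *: (x - y).
have hlf (z : H) : (2^-1)%:C *: z + (2^-1)%:C *: z = z.
  by rewrite -scalerDl -rmorphD /= (_ : 2^-1 + 2^-1 = 1) ?scale1r//; lra.
have pd : p + d = x.
  by rewrite /p /d -scalerDr addrACA subrr addr0 scalerDr hlf.
have pmd : p - d = y.
  by rewrite /p /d -scalerBr opprD opprK addrACA subrr add0r scalerDr hlf.
(* The hypothesis on [x - y] keeps this dilate of [d] in the unit ball. After [n] doublings
   [2^n |D x - D y|] is bounded by the values at [p + dn] and [p - dn], together at most [4 m]. *)
pose dn := (2 ^+ n)%:C *: d.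
have dbl (z w : H) : D (z + w + w) - D (z - w - w) = 2 * (D (z + w) - D (z - w)).
  have := Dpar (z + w) w; have := Dpar (z - w) w.
  by rewrite addrK subrK; lra.
have key j : D (p + (2 ^+ j)%:C *: d) - D (p - (2 ^+ j)%:C *: d) =
    2 ^+ j * (D x - D y).
  elim: j => [|j IH]; first by rewrite expr0 scale1r pd pmd mul1r.
  rewrite exprS [2 * _]mulr_natl mulr2n rmorphD /= scalerDl opprD !addrA dbl IH.
  ring.
have np : nsq p <= 1.
  rewrite nsqZ normc2R; have := nsqD_le x y; rewrite x1 y1; nra.
have nd : nsq dn <= 1.
  rewrite nsqZ nsqZ !normc2R; have := nsq_ge0 (x - y).
  rewrite -exprM mulnC exprM -natrX => h.
  have h4 : 0 <= (4%:R ^+ n : R) by rewrite exprn_ge0.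
  have := ler_wpM2l h4 xy; rewrite -exprMn mulfV// expr1n.
  by have := nsq_ge0 (x - y); nra.
have h1 := Dbd (p + dn); have h2 := Dbd (p - dn).
have e2 : 0 < 2 ^+ n :> R by rewrite exprn_gt0.
rewrite -(ler_pM2l e2) -{1}[2 ^+ n](ger0_norm (ltW e2)) -normrM -key -/dn.
have -> : 2 ^+ n * (4 * m * 2^-1 ^+ n) = 4 * m.
  by rewrite mulrCA -exprMn mulfV// expr1n mulr1.
apply: le_trans (ler_normB _ _) _.
have := ler_wpM2l m0 np; have := ler_wpM2l m0 nd.
have := congr1 (fun t => m * t) (nsq_par p dn) => /=; lra.
Qed.

(** * The sum over the scales *)

Section Potential.
Variables (R : realType) (G : topologicalGroupType) (H : hilbertType R).
Variables (pi : G -> H -> H).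
Hypothesis pi_rep : unitary_rep pi.
Variables (s : seq G) (rho : R).
Hypothesis s_inv : forall g, g \in s -> g^-1%g \in s.
Hypothesis rho_lt : 0 < rho < (size s)%:R.

(** The order of the quantifiers matters: [m] counts the scales by which an element of [s] can move
    [q], which depends on [s] and [rho] only, whereas the number [J] of scales in the sum grows with
    [C]. So the differences stay in one compact box while [E] grows. *)
Lemma exists_potential : exists2 m : R, 0 < m &
  forall (E : seq H) (q : H -> R) (C : R),
    (forall x, 0 <= q x) ->
    (forall x y, q (x + y) + q (x - y) = 2 * (q x + q y)) ->
    (forall x, \sum_(g <- s) q (pi g^-1%g x) <= rho * q x) ->
    (forall x, q x <= C * nsq x) ->
    (forall x y, x \in E -> sqinner x y <= q y) ->
    (forall x, x \in E -> nsq x = 1) ->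
  exists b : H -> R,
    [/\ forall x y, b (x + y) + b (x - y) = 2 * (b x + b y),
        forall g x, g \in s -> `|b x - b (pi g^-1%g x)| <= m * nsq x &
        forall x, x \in E -> 2^-1 <= \sum_(g <- s) (b x - b (pi g^-1%g x))].
Proof.
pose n : R := (size s)%:R; have [r0 rn] := andP rho_lt.
have n0 : 0 < n by apply: lt_trans rn.
have n1 : 1 <= n.
  by move: n0; rewrite /n ltr0n => n0; rewrite ler1n.
pose l := rho / n.
have l0 : 0 < l by rewrite divr_gt0.
have l01 : 0 < l < 1 by rewrite l0 ltr_pdivrMr// mul1r.
have ninv : 0 < n^-1 by rewrite invr_gt0.
(* An element of [s] multiplies [q] by at most [n < l^-k0], so it moves the scale by at most [k0]
   steps. The bound returned is [k0.+1], to be positive. *)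
have [k0 hk] := expr_lt_eps l01 ninv.
exists (k0.+1%:R) => // E q C q0 qpar qs qC qE E1.
(* Small enough for [r 0 <= 1/4] on [E]; below, [J] is taken large enough for [c J >= 3], hence
   [r J >= 3/4] on [E]. *)
pose c0 : R := (4 * (`|C| + 1))^-1.
have c0p : 0 < c0 by rewrite invr_gt0 mulr_gt0// ltr_wpDl.
pose c j := c0 / l ^+ j.
have cp j : 0 < c j by rewrite divr_gt0// exprn_gt0.
have c_ge0 j : 0 <= c j := ltW (cp j).
have c03 : 0 < c0 / 3 by rewrite divr_gt0.
have [J hJ] := expr_lt_eps l01 c03.
have cJ : 3 <= c J.
  rewrite ler_pdivlMr ?exprn_gt0//; move: hJ; rewrite ltr_pdivlMr//; lra.
have cS j : c j.+1 * rho = n * c j.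
  rewrite /c exprS /l; field.
  by rewrite expf_neq0 ?gt_eqF//= !gt_eqF// divr_gt0.
pose r j := inf_conv q (c j).
have r_ge0 j x : 0 <= r j x by exact: inf_conv_ge0.
pose b x := \sum_(0 <= j < J) r j.+1 x.
have q_le g x : g \in s -> q (pi g^-1%g x) <= n * q x.
  move=> gs; apply: le_trans (_ : rho * q x <= _); last by rewrite ler_wpM2r// ltW.
  apply: le_trans (qs x); rewrite (big_rem g)//= lerDl.
  exact: sumr_ge0.
have r_shift g j x : g \in s -> r j (pi g^-1%g x) <= r (j + k0)%N x.
  move=> gs; apply: inf_conv_ge => y.
  apply: le_trans (inf_conv_le q0 _ (pi g^-1%g y) (c_ge0 j)) _.
  rewrite -(repB pi_rep) (rep_nsq pi_rep) lerD2r.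
  apply: le_trans (ler_wpM2l (c_ge0 j) (q_le _ y gs)) _.
  rewrite mulrA ler_wpM2r// /c exprD invfM mulrA ler_wpM2l ?(ltW (cp j))//.
  by rewrite -[leLHS]invrK lef_pV2 ?posrE ?invr_gt0 ?exprn_gt0// ltW.
(* After a shift by [k0] scales at most [k0] terms leave the range of [b], each of them at most
   [nsq x]. *)
have b_le g x : g \in s -> b (pi g^-1%g x) <= b x + k0%:R * nsq x.
  move=> gs.
  apply: (@le_trans _ _ (\sum_(0 <= j < J) r (j + k0).+1 x)).
    by apply: ler_sum => j _; rewrite -addSn r_shift.
  apply: (@le_trans _ _ (\sum_(0 <= j < k0 + J) r j.+1 x)).
    rewrite [leRHS](@big_cat_nat _ _ _ k0) ?leq_addr//=.
    have -> : \sum_(k0 <= j < k0 + J) r j.+1 x = \sum_(0 <= j < J) r (j + k0).+1 x.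
      by rewrite -{1}[k0]add0n big_addn addKn.
    by rewrite lerDr sumr_ge0.
  rewrite addnC [leLHS](@big_cat_nat _ _ _ J) ?leq_addr//= lerD2l.
  apply: (@le_trans _ _ (\sum_(J <= j < J + k0) nsq x)).
    by apply: ler_sum => j _; exact: inf_conv_le_nsq.
  by rewrite big_const_nat iter_addr addr0 addKn mulr_natl.
exists b; split.
- move=> x y; rewrite /b -!big_split mulr_sumr; apply: eq_bigr => j _.
  exact: inf_conv_par.
- move=> g x gs; have := nsq_ge0 x => nx.
  have h1 := b_le g x gs.
  (* The opposite bound comes from the inverse element at the translated point. *)
  have := b_le _ (pi g^-1%g x) (s_inv gs).
  rewrite invgK (repVK pi_rep) (rep_nsq pi_rep) => h2.
  by rewrite ler_norml -natr1; apply/andP; split; lra.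
- move=> x xE.
  (* One [y] serves all [g], through the competitors [pi g^-1%g y]. Superharmonicity of [q] with
     [c j.+1 * rho = n * c j] lowers the scale by one step, so the sum over [j] telescopes to
     [n * (r J x - r 0 x)]. *)
  have sum_le j : \sum_(g <- s) r j.+1 (pi g^-1%g x) <= n * r j x.
    rewrite -ler_pdivrMl//; apply: inf_conv_ge => y; rewrite ler_pdivrMl//.
    apply: (@le_trans _ _ (\sum_(g <- s) (c j.+1 * q (pi g^-1%g y) + nsq (x - y)))).
      apply: ler_sum => g _;
        apply: le_trans (inf_conv_le q0 _ (pi g^-1%g y) (c_ge0 _)) _.
      by rewrite -(repB pi_rep) (rep_nsq pi_rep).
    rewrite big_split /= -mulr_sumr big_const_seq count_predT iter_addr addr0.
    rewrite -mulr_natl -/n mulrDr (mulrA n (c j)) -cS -mulrA lerD2r.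
    exact: ler_wpM2l.
  rewrite sumrB big_const_seq count_predT iter_addr addr0 -[b x *+ _]mulr_natl -/n.
  have -> : \sum_(g <- s) b (pi g^-1%g x) =
      \sum_(0 <= j < J) \sum_(g <- s) r j.+1 (pi g^-1%g x).
    by rewrite exchange_big.
  have h : \sum_(0 <= j < J) \sum_(g <- s) r j.+1 (pi g^-1%g x) <=
      n * \sum_(0 <= j < J) r j x.
    by rewrite mulr_sumr; apply: ler_sum => j _; exact: sum_le.
  apply: le_trans (lerB (lexx _) h); rewrite -mulrBr /b -sumrB.
  rewrite (telescope_sumr (fun j => r j x))//.
  have rJ : 3 / 4 <= r J x.
    by apply: inf_conv_unit_ge => //; [exact: E1 | move=> y; exact: qE].
  have r0x : r 0 x <= 4^-1.
    apply: le_trans (inf_conv_le_quad q0 _ (c_ge0 0)) _.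
    rewrite /c expr0 divr1 /c0 ler_pdivrMl ?mulr_gt0 ?ltr_wpDl//.
    have := qC x; rewrite (E1 x xE) mulr1; have := ler_norm C; lra.
  by nra.
Qed.

End Potential.

(** * The compact space and the invariant mean *)

Section PointedSubspace.
Variables (T : topologicalType) (P : T -> Prop).

(** The point is a parameter of the type so that the type can carry the [isPointed] instance that
    [amenable] asks for. *)
Definition pointed_subspace (x0 : {x : T | `[<P x>]}) :=
  initial_topology (val : {x : T | `[<P x>]} -> T).

Variable x0 : {x : T | `[<P x>]}.
Local Notation X := (pointed_subspace x0).
HB.instance Definition _ := Topological.on X.
HB.instance Definition _ := isPointed.Build X x0.

Definition psub_val (x : X) : T := val x.

Lemma psub_val_continuous : continuous psub_val.
Proof. exact: initial_continuous. Qed.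

Lemma psub_cvg (F : set_system X) (FF : Filter F) (x : X) :
  psub_val @ F --> psub_val x -> F --> x.
Proof.
move=> h A [B [[C oC <-] Cx] sub]; apply: (filterS sub).
by apply: h; exact: open_nbhs_nbhs.
Qed.

Lemma psub_compact : compact [set x | P x] -> compact [set: X].
Proof.
move=> cP F PF _.
have [|y [Py cl]] := cP _ (fmap_proper_filter psub_val PF).
  by apply: (@filterS _ F _ setT) filterT => x _; apply/asboolP; exact: (valP x).
have Py' : `[<P y>] by apply/asboolP.
exists (exist _ y Py'); split=> // A B FA [_ [[C oC <-] Cy] CB].
have [||_ [[z Az <-] Cz]] := cl (psub_val @` A) C.
- change (F (psub_val @^-1` (psub_val @` A))).
  by apply: filterS FA => z Az; exists z.
- exact: open_nbhs_nbhs.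
- by exists z; split=> //; exact: CB.
Qed.

Lemma psub_hausdorff : hausdorff_space T -> hausdorff_space X.
Proof.
move=> hT p q pq; apply: val_inj; apply: hT => A B nA nB.
have [z [Az Bz]] := pq _ _ (psub_val_continuous nA) (psub_val_continuous nB).
by exists (val z).
Qed.

End PointedSubspace.

Lemma closure_le (R : realType) (T : topologicalType) (phi : T -> R) (A : set T) c p :
  continuous phi -> (forall x, A x -> phi x <= c) -> closure A p -> phi p <= c.
Proof.
move=> cphi Ac clA; rewrite leNgt; apply/negP => cp.
have h : nbhs p [set x | c < phi x].
  have := cphi p; move=> /cvgr_gt; apply; exact: cp.
by have [x [/Ac xc]] := clA _ h; rewrite /= ltNge xc.
Qed.

(** * Integrals of bounded continuous functions *)

Section InvariantMean.
Variables (R : realType) (X : ptopologicalType).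
Variable mu : probability (borel X) R.

Lemma continuous_borel_measurable (f : X -> R) : continuous f ->
  measurable_fun setT (f : borel X -> R).
Proof.
move=> cf; apply: (measurability (@RGenOInfty.G R));
  first exact: RGenOInfty.measurableE.
move=> _ [_ [x ->] <-]; rewrite setTI; apply: sub_sigma_algebra.
by move/continuousP : cf; apply; exact: interval_open.
Qed.

Lemma continuous_borel_borel (f : X -> X) : continuous f ->
  measurable_fun setT (f : borel X -> borel X).
Proof.
move=> cf; apply: (@measurability _ _ (borel X) (borel X) setT f (@open X)) => //.
move=> _ [A oA <-]; rewrite setTI; apply: sub_sigma_algebra.
by move/continuousP : cf; apply.
Qed.

Definition continuous_bounded (f : X -> R) : Prop :=
  continuous f /\ exists M, forall x, `|f x| <= M.

Lemma continuous_bounded_integrable f : continuous_bounded f ->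
  mu.-integrable setT (EFin \o (f : borel X -> R)).
Proof.
move=> [cf [M fM]]; apply: measurable_bounded_integrable => //.
- by rewrite (le_lt_trans (probability_le1 _ _))// ltry.
- exact: continuous_borel_measurable.
- by exists M; split=> [|N MN x _]; [exact: num_real | exact: le_trans (fM x) (ltW MN)].
Qed.

Lemma Rintegral_invariant (f : X -> R) (phi : X -> X) :
  continuous_bounded f -> continuous phi ->
  (forall A : set X, measurable (A : set (borel X)) -> mu (phi @^-1` A) = mu A) ->
  (\int[mu]_x f (phi x) = \int[mu]_x f x)%R.
Proof.
move=> fb cphi inv; rewrite /Rintegral; congr fine.
have mphi := continuous_borel_borel cphi.
have mf : measurable_fun setT (EFin \o (f : borel X -> R)).
  by apply/measurable_EFinP; apply: continuous_borel_measurable; case: fb.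
have fphi : mu.-integrable setT ((EFin \o (f : borel X -> R)) \o phi).
  apply: (@continuous_bounded_integrable (f \o phi)); case: fb => cf [M fM].
  by split; [move=> x; apply: continuous_comp;
    [exact: cphi | exact: cf] | exists M => x; exact: fM].
have := @integral_pushforward _ _ _ _ R _ mphi mu setT _ mf fphi measurableT.
move=> h; rewrite -[LHS]h; apply: eq_measure_integral => A mA _.
exact: inv.
Qed.

(** By invariance [f i] and [f i \o phi i] have equal integrals, so the sum has integral [0]; under
    a probability measure the lower bound would make it at least [2^-1]. *)
Lemma invariant_mean_sum (I : Type) (r : seq I) (f : I -> X -> R) (phi : I -> X -> X) :
  (forall i, continuous_bounded (f i)) -> (forall i, continuous (phi i)) ->
  (forall i (A : set X), measurable (A : set (borel X)) -> mu (phi i @^-1` A) = mu A) ->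
  ~ (forall x, 2^-1 <= \sum_(i <- r) (f i x - f i (phi i x))).
Proof.
move=> fb cphi inv h.
have fphi i : continuous_bounded (f i \o phi i).
  case: (fb i) => cf [M fM]; split; last by exists M => x; exact: fM.
  by move=> x; apply: continuous_comp; [exact: cphi | exact: cf].
have key : mu.-integrable setT (EFin \o (fun x :
  borel X => \sum_(i <- r) (f i x - f i (phi i x)))) /\
    (\int[mu]_x (\sum_(i <- r) (f i x - f i (phi i x))) = 0)%R.
  elim: r {h} => [|i r [IH1 IH2]].
    have -> : (fun x : borel X => \sum_(i <- [::]) (f i x - f i (phi i x))) = cst 0.
      by apply/funext => x; rewrite big_nil.
    split; last by rewrite Rintegral_cst// mul0r.
    apply: (@continuous_bounded_integrable (cst 0)); split; first exact: cst_continuous.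
    by exists 0 => x; rewrite normr0.
  have -> : (fun x : borel X => \sum_(j <- i :: r) (f j x - f j (phi j x))) =
      (fun x => (f i x - f i (phi i x)) + \sum_(j <- r) (f j x - f j (phi j x))).
    by apply/funext => x; rewrite big_cons.
  have i1 := continuous_bounded_integrable (fb i).
  have i2 := continuous_bounded_integrable (fphi i).
  have i12 : mu.-integrable setT (EFin \o (fun x : borel X => f i x - f i (phi i x))).
    by have := integrableB measurableT i1 i2; apply: eq_integrable => // x _.
  split.
    by have := integrableD measurableT i12 IH1; apply: eq_integrable => // x _.
  rewrite RintegralD// IH2 addr0 RintegralB//.
  by rewrite [X in _ - X](Rintegral_invariant (fb i) (cphi i) (inv i)) subrr.
have [k1 k2] := key.
have k3 : mu.-integrable setT (EFin \o (cst 2^-1 : borel X -> R)).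
  apply: (@continuous_bounded_integrable (cst 2^-1)); split;
    first exact: cst_continuous.
  by exists (2^-1) => x /=; rewrite ger0_norm.
have mu1 : fine (mu setT) = 1 by rewrite [X in fine X]probability_setT.
have := le_Rintegral measurableT k3 k1 (fun x _ => h x).
by rewrite k2 Rintegral_cst// mu1 mulr1 leNgt invr_gt0 ltr0n.
Qed.

End InvariantMean.

Lemma prod_topology_cvg (I : Type) (K : topologicalType) (S : Type)
    (F : set_system S) (FF : Filter F) (f : S -> prod_topology (fun _ : I => K))
    (y : prod_topology (fun _ : I => K)) :
  (forall i, f x i @[x --> F] --> y i) -> f @ F --> y.
Proof.
move=> h; apply/cvg_sup => i A [_ [[C oC <-] Cy] sub].
change (F (f @^-1` A)).
have FC : F [set x | C (f x i)] by apply: (h i); exact: open_nbhs_nbhs.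
by apply: filterS FC => x Cx; exact: sub.
Qed.

(** * The compact flow of potential differences *)

Section AmenableContradiction.
Variables (R : realType) (G : topologicalGroupType) (H : hilbertType R).
Variables (pi : G -> H -> H).
Hypotheses (pi_rep : unitary_rep pi) (pi_cont : strongly_continuous pi).
Hypothesis hSIN : SIN G.
Variables (xi : H) (qs : seq G) (m : R).
Hypotheses (xi1 : nsq xi = 1) (m_gt0 : 0 < m).

Let s := [:: 1%g, 1%g & qs ++ [seq g^-1%g | g <- qs]].

Hypothesis potential : forall E : seq H, (forall x, x \in E -> nsq x = 1) ->
  exists b : H -> R,
    [/\ forall x y, b (x + y) + b (x - y) = 2 * (b x + b y),
        forall g x, g \in s -> `|b x - b (pi g^-1%g x)| <= m * nsq x &
        forall x, x \in E -> 2^-1 <= \sum_(g <- s) (b x - b (pi g^-1%g x))].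

(** All conjugates of [k] are included because left translation of a function by [a] replaces [k] by
    [a^-1 k a]. That such [k] still form a neighbourhood of the identity is the SIN property. *)
Definition uniformly_small (n : nat) (k : G) : Prop :=
  forall a : G, nsq (xi - pi (a * k * a^-1)%g xi) <= 4^-1 ^+ n.

Lemma uniformly_small_conj n k a : uniformly_small n k ->
  uniformly_small n (a * k * a^-1)%g.
Proof. by move=> hk b; have := hk (b * a)%g; rewrite invgM !mulgA. Qed.

Lemma uniformly_small_nbhs n : nbhs (1%g : G) (uniformly_small n).
Proof.
have e0 : 0 < 4^-1 ^+ n :> R by rewrite exprn_gt0// invr_gt0.
have [V [nV Vinv sub]] := hSIN (rep_nbhs1 pi_rep pi_cont xi e0).
apply: filterS nV => k Vk a; apply/ltW; exact: (sub _ (Vinv a k Vk)).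
Qed.

Local Notation fspace := (prod_topology (fun _ : G * G => R : topologicalType)).

(** For [g] in [s], [F (g, h)] stands for [b (h^-1 xi) - b (g^-1 h^-1 xi)]. With [x = h^-1 xi] the
    last summand is then [2 b x - b (g^-1 x) - b (g x)], so summing over [qs] accounts for all of
    [s], in the form of functions minus translates, which an invariant mean kills. *)
Definition flow_space (F : fspace) : Prop :=
  [/\ forall i, - m <= F i <= m,
      forall n k, uniformly_small n k -> forall g h,
        `|F (g, (k * h)%g) - F (g, h)| <= 4 * m * 2^-1 ^+ n &
      forall h, 2^-1 <= \sum_(g <- qs) (F (g, h) - F (g, (h * g^-1)%g))].

Lemma eval_continuous (i : G * G) : continuous (fun F : fspace => F i).
Proof. exact: (@proj_continuous _ (fun _ : G * G => R : topologicalType) i). Qed.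

Lemma box_compact : compact [set F : fspace | forall i, - m <= F i <= m].
Proof.
have := @tychonoff (G * G)%type (fun _ => R : topologicalType)
  (fun _ => `[- m, m]%classic) (fun _ => @segment_compact R (- m) m).
by congr (compact _); apply/seteqP; split=> F h i; have := h i; rewrite /= in_itv.
Qed.

Let variation (g h h' : G) (F : fspace) : R := `|F (g, h) - F (g, h')|.
Let variation_continuous g h h' : continuous (variation g h h').
Proof.
move=> F; apply: (@cvg_norm _ _ _ (nbhs F)).
by apply: (@cvgB _ _ _ (nbhs F)); exact: eval_continuous.
Qed.

Let defect (h : G) (F : fspace) : R :=
  - \sum_(g <- qs) (F (g, h) - F (g, (h * g^-1)%g)).
Let defect_continuous h : continuous (defect h).
Proof.
move=> F; apply: (@cvgN _ _ _ (nbhs F)).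
apply: (@cvg_big _ G _ _ _ add_continuous _ (nbhs F) qs
  (fun g F => F (g, h) - F (g, (h * g^-1)%g))) => g _.
by apply: (@cvgB _ _ _ (nbhs F)); exact: eval_continuous.
Qed.

Lemma flow_space_compact : compact flow_space.
Proof.
move=> F PF FP.
have [|p [bp clp]] := box_compact (F := F) PF.
  by apply: filterS FP => f [].
exists p; split=> //.
have clP : closure flow_space p by move: clp; rewrite clusterE; apply.
split=> // [n k hk g h|h].
  change (variation g (k * h)%g h p <= 4 * m * 2^-1 ^+ n).
  by apply: (closure_le (@variation_continuous g (k * h)%g h) _ clP) => f [_ + _];
    apply.
have : defect h p <= - 2^-1.
  apply: (closure_le (@defect_continuous h) _ clP) => f [_ _ hf].
  by rewrite lerN2.
by rewrite lerN2.
Qed.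

(** The set [B E] asks for the last condition on [E] only. For finite [E] it contains the
    differences of a potential; a cluster point in the compact box of these nested closed conditions
    satisfies all of them. *)
Lemma flow_space_nonempty : exists F, flow_space F.
Proof.
pose B (E : set G) : set fspace := [set F : fspace |
  [/\ forall i, - m <= F i <= m,
      forall n k, uniformly_small n k -> forall g h,
        `|F (g, (k * h)%g) - F (g, h)| <= 4 * m * 2^-1 ^+ n &
      forall h, E h -> 2^-1 <= \sum_(g <- qs) (F (g, h) - F (g, (h * g^-1)%g))]].
pose D := [set E : set G | exists r : seq G, E = [set h | h \in r]].
have PF : ProperFilter (filter_from D B).
  apply: filter_from_proper.
    apply: filter_from_filter; first by exists [set h | h \in [::]], [::].
    move=> _ _ [r1 ->] [r2 ->]; exists [set h | h \in r1 ++ r2];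
      first by exists (r1 ++ r2).
    move=> F [F1 F2 F3]; split; split=> // h hr; apply: F3; rewrite /= mem_cat.
      by rewrite [_ \in r1]hr.
    by rewrite [_ \in r2]hr orbT.
  move=> _ [r ->].
  have [|b [bpar bbd bsum]] := potential (E := [seq pi h^-1%g xi | h <- r]).
    by move=> x /mapP [h _ ->]; rewrite (rep_nsq pi_rep).
  pose Dg g x := b x - b (pi g^-1%g x).
  (* The potential is controlled only for [g] in [s]; the value [0] elsewhere respects the first two
     conditions, and the third involves only [qs]. *)
  exists (fun i => if i.1 \in s then Dg i.1 (pi i.2^-1%g xi) else 0); split.
  - move=> [g h] /=; rewrite -ler_norml; case: ifP => [gs|_];
    last by rewrite normr0 ltW.
    by have := bbd g (pi h^-1%g xi) gs; rewrite (rep_nsq pi_rep) xi1 mulr1.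
  - move=> n k hk g h /=; case: ifP => [gs|_]; last first.
      by rewrite subrr normr0 mulr_ge0 ?exprn_ge0 ?invr_ge0// mulr_ge0// ltW.
    apply: bounded_quad_equicontinuous; rewrite ?(rep_nsq pi_rep)//.
    + move=> x y; rewrite /Dg (repD pi_rep) (repB pi_rep).
      by have := bpar x y; have := bpar (pi g^-1%g x) (pi g^-1%g y); lra.
    + by move=> x; exact: bbd.
    + rewrite invgM (repM pi_rep) -(repB pi_rep) (rep_nsq pi_rep).
      have := hk 1%g; rewrite mul1g invg1 mulg1 => hk1.
      rewrite -(rep_nsq pi_rep k) (repB pi_rep) (repVK pi_rep).
      exact: hk1.
  - move=> h hr /=; set x := pi h^-1%g xi.
    have xE : x \in [seq pi h^-1%g xi | h <- r] by apply: map_f.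
    apply: le_trans (bsum x xE) _.
    (* The identities in [s] contribute nothing; the terms of [g] and [g^-1] are merged for each [g]
       in [qs]. *)
    rewrite !big_cons invg1 (rep1 pi_rep) subrr !add0r big_cat big_map /=.
    rewrite -big_split big_seq [leRHS]big_seq; apply: ler_sum => g gq /=.
    have gs : g \in s by rewrite !in_cons mem_cat gq !orbT.
    rewrite gs invgK invgM invgK (repM pi_rep) -/x /Dg (repK pi_rep).
    lra.
have [|p [bp clp]] := box_compact (F := filter_from D B) PF.
  by exists [set h | h \in [::]]; [exists [::] | move=> F []].
have clB (E : set G) : D E -> closure (B E) p.
  by move=> DE; move: clp; rewrite clusterE; apply; exists E.
exists p; split=> // [n k hk g h|h].
  have cl := clB _ (ex_intro _ [::] erefl : D [set h | h \in [::]]).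
  change (variation g (k * h)%g h p <= 4 * m * 2^-1 ^+ n).
  by apply: (closure_le (@variation_continuous g (k * h)%g h) _ cl) => f [_ + _]; apply.
have cl := clB _ (ex_intro _ [:: h] erefl : D [set h' | h' \in [:: h]]).
have : defect h p <= - 2^-1.
  apply: (closure_le (@defect_continuous h) _ cl) => f [_ _ hf].
  by rewrite lerN2; apply: hf => /=; rewrite inE.
by rewrite lerN2.
Qed.

Definition flow_act (a : G) (F : fspace) : fspace := fun i => F (i.1, (a^-1 * i.2)%g).

Lemma flow_act_space a F : flow_space F -> flow_space (flow_act a F).
Proof.
move=> [F1 F2 F3]; split=> [i|n k hk g h|h]; first exact: F1.
  rewrite /flow_act /=.
  have := F2 n _ (uniformly_small_conj a^-1%g hk) g (a^-1 * h)%g.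
  by rewrite invgK -!mulgA mulVKg.
apply: le_trans (F3 (a^-1 * h)%g) _; apply: ler_sum => g _.
by rewrite /flow_act /= mulgA.
Qed.

Lemma amenable_absurd : amenable R G -> False.
Proof.
move=> hamen.
have [F0 hF0] := flow_space_nonempty.
have hF0' : `[<flow_space F0>] by apply/asboolP.
pose x0 : {F : fspace | `[<flow_space F>]} := exist _ F0 hF0'.
pose X := pointed_subspace x0.
pose pv : X -> fspace := @psub_val _ _ x0.
have memX (x : X) : flow_space (pv x) by apply/asboolP; exact: (valP x).
pose act (a : G) (x : X) : X :=
  exist (fun F => `[<flow_space F>]) (flow_act a (pv x))
    (introT (asboolP _) (flow_act_space a (memX x))).
have ev_cont i : continuous (fun x : X => pv x i).
  move=> x; apply: (@continuous_comp _ _ _ pv (fun F : fspace => F i)).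
    exact: psub_val_continuous.
  exact: eval_continuous.
have joint (i : G * G) : continuous (fun p : G * X => pv (act p.1 p.2) i).
  move=> [a x]; apply/cvgrPdist_lt => e e0.
  have [n hn] : exists n, 2^-1 ^+ n < e / 2 / (4 * m) :> R.
    apply: expr_lt_eps; first by rewrite invr_gt0 ltr0n /= invf_lt1 ?ltr1n.
    by rewrite !divr_gt0// mulr_gt0.
  have e2 : 0 < e / 2 by rewrite divr_gt0.
  (* Since [a'^-1 h = (a'^-1 a) (a^-1 h)], for such [a'] replacing [a] by [a'] costs less than
     [e / 2] at all points of [X] at once. *)
  have na : nbhs a [set a' | uniformly_small n (a'^-1 * a)%g].
    have c : (a'^-1 * a)%g @[a' --> a] --> (1%g : G).
      rewrite -(mulVg a).
      apply: (@cvg_comp _ _ _ (fun a' : G => (a'^-1%g, a))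
                (fun p : G * G => (p.1 * p.2)%g) _ (nbhs (a^-1%g, a))).
        by apply: cvg_pair => /=; [exact: (invg_continuous a) | exact: cvg_cst].
      exact: (mulg_continuous (a^-1%g, a)).
    exact: (c _ (uniformly_small_nbhs n)).
  have := ev_cont (i.1, (a^-1 * i.2)%g) x => /cvgrPdist_lt /(_ _ e2) nx.
  exists ([set a' | uniformly_small n (a'^-1 * a)%g],
     [set x' : X | `|pv x (i.1, (a^-1 * i.2)%g) - pv x' (i.1, (a^-1 * i.2)%g)| < e /
       2]).
    by split.
  move=> [a' x'] [/= ha' hx'].
  have [_ F2 _] := memX x'.
  have := F2 n _ ha' i.1 (a^-1 * i.2)%g; rewrite -mulgA mulVKg => h1.
  change (`|pv x (i.1, (a^-1 * i.2)%g) - pv x' (i.1, (a'^-1 * i.2)%g)| < e).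
  have h2 : `|pv x' (i.1, (a'^-1 * i.2)%g) - pv x' (i.1, (a^-1 * i.2)%g)| < e / 2.
    apply: le_lt_trans h1 _; rewrite mulrC -ltr_pdivlMr// mulr_gt0//.
  apply: le_lt_trans (ler_distD (pv x' (i.1, (a^-1 * i.2)%g)) _ _) _.
  by rewrite [ltRHS]splitr ltrD// distrC.
have act_cont : continuous (fun p : G * X => act p.1 p.2).
  move=> p; apply: psub_cvg; apply: prod_topology_cvg => i; exact: joint.
have cX : compact [set: X] by apply: psub_compact; exact: flow_space_compact.
have hX : hausdorff_space X.
  apply: psub_hausdorff.
  exact: (@hausdorff_product (G * G)%type (fun _ => R :
    topologicalType) (fun _ => @Rhausdorff R)).
have hact : continuous_action act.
  split=> //.
  - move=> x; apply: val_inj; apply/funext => i.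
    by rewrite /= /flow_act invg1 mul1g -surjective_pairing.
  - move=> g h x; apply: val_inj; apply/funext => i.
    by rewrite /= /flow_act /pv /psub_val /= /flow_act invgM mulgA.
have [mu [_ inv]] := hamen X act cX hX hact.
have act1_cont a : continuous (act a).
  move=> x A nA.
  have [[U V] [/= nU nV] sub] : nbhs (a, x) [set p : G * X | A (act p.1 p.2)].
    exact: (act_cont (a, x) A nA).
  change (nbhs x [set z | A (act a z)]).
  by apply: filterS nV => z Vz; apply: (sub (a, z)); split=> //; exact: nbhs_singleton.
(* The condition involves right translations and the action is by left ones; they agree at [h = 1],
   where [F (g, g^-1)] is the value of [flow_act g F] at [(g, 1)]. *)
apply: (@invariant_mean_sum R X mu G qs (fun g x => pv x (g, 1%g)) act).
- move=> g; split; first exact: ev_cont.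
  exists m => x; rewrite ler_norml; have [F1 _ _] := memX x; exact: F1.
- exact: act1_cont.
- by move=> g A mA; exact: inv.
- move=> x; have [_ _ /(_ 1%g) h1] := memX x.
  apply: le_trans h1 _; apply: ler_sum => g _.
  by rewrite /pv /psub_val /= /flow_act /= mulg1 mul1g.
Qed.

End AmenableContradiction.

Theorem corollary1p3 (R : realType) (G : topologicalGroupType)
    (hG : hausdorff_space G)
    (hMAP : minimally_almost_periodic R G)
    (hSIN : SIN G)
    (hrep : has_nontrivial_unitary_rep R G)
    (hamen : amenable R G) :
  ~ strong_property_T R G.
Proof.
move=> [Q /finite_seqP [qs ->] hQ].
have [H [pi [pr pc pf [x xn]]]] := rep_without_invariant_vectors hrep.
pose xi := ((Num.sqrt (nsq x))^-1)%:C *: x.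
have xi1 : nsq xi = 1.
  have x0 : 0 < nsq x.
    by rewrite lt_def nsq_ge0 andbT; apply: contra xn => /eqP /nsq_eq0 ->.
  by rewrite nsqZ normc2R exprVn sqr_sqrtr ?nsq_ge0// mulVf// gt_eqF.
(* This identity keeps [s'] nonempty when [qs] is empty. The one added in [1%g :: s'] is the partner
   of the moving element in the contraction. *)
pose s' := 1%g :: (qs ++ [seq g^-1%g | g <- qs]).
have Qs g : [set` qs] g -> g \in s'.
  by move=> gq; rewrite in_cons mem_cat [g \in qs]gq orbT.
have [theta /andP[th0 thn] contr] := form_sum_contraction pr pc pf hMAP hQ Qs isT.
(* Above [theta] the series for [q] converges; below the size of [1%g :: s'] the scales of the
   potential have ratio less than one. *)
pose rho := (theta + (size s').+1%:R) / 2.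
have th_rho : 0 <= theta < rho by rewrite th0 /= /rho; lra.
have rho_n : 0 < rho < (size (1%g :: s'))%:R.
  have -> : size (1%g :: s') = (size s').+1 by [].
  by apply/andP; split; rewrite /rho; lra.
have s_inv g : g \in 1%g :: s' -> g^-1%g \in 1%g :: s'.
  rewrite !in_cons !mem_cat => /or4P[/eqP->|/eqP->|gq|/mapP [h hq ->]].
  - by rewrite invg1 eqxx.
  - by rewrite invg1 eqxx.
  - by rewrite (map_f (fun g : G => g^-1%g) gq) !orbT.
  - by rewrite invgK hq !orbT.
have [m m0 pot] := exists_potential pr s_inv rho_n.
apply: (@amenable_absurd R G H pi pr pc hSIN xi qs m xi1 m0 _ hamen) => E E1.
have [q [C [q0 qpar qs' qC qE]]] := exists_superharmonic pr th_rho contr E.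
exact: (pot E q C).
Qed.
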